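(* Let $X$ be a subshift over a non-empty alphabet $\mathscr{A}$ and let $R$ be a commutative unital ring without zero divisors. Then the unital subshift algebra $\widetilde{\mathcal{A}}_R(X)$ is semiprime.
   Context: Conventions: $\mathbb{N}=\{0,1,2,\ldots\}$. $\mathscr{A}$ is a non-empty (possibly infinite) set, the alphabet; $\mathscr{A}^*$ is the set of finite words over $\mathscr{A}$, $\omega$ the empty word, $\beta\alpha$ concatenation. A subshift $X\subseteq\mathscr{A}^{\mathbb{N}}$ is a set of the form $X=X_F$ for some $F\subseteq\mathscr{A}^*$, where $X_F$ is the set of all sequences in $\mathscr{A}^{\mathbb{N}}$ containing no word of $F$ as a (consecutive) subword. The language $\mathcal{L}_X$ is the set of all finite words (including $\omega$) that appear in some sequence of $X$. For $\alpha,\beta\in\mathcal{L}_X$ let $C(\alpha,\beta)=\{\beta x\in X:\alpha x\in X\}$; note $X=C(\omega,\omega)$. $\mathcal{U}$ is the Boolean algebra of subsets of $X$ generated by all $C(\alpha,\beta)$, $\alpha,\beta\in\mathcal{L}_X$. The unital subshift algebra $\widetilde{\mathcal{A}}_R(X)$ is the universal unital $R$-algebra with generators $\{p_A:A\in\mathcal{U}\}$ and $\{s_a,s_a^*:a\in\mathscr{A}\}$ subject to: (i) $p_X=1$, $p_{A\cap B}=p_Ap_B$, $p_{A\cup B}=p_A+p_B-p_{A\cap B}$, $p_\emptyset=0$ for all $A,B\in\mathcal{U}$; (ii) $s_as_a^*s_a=s_a$ and $s_a^*s_as_a^*=s_a^*$ for all $a\in\mathscr{A}$; (iii) $s_\beta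 s_\alpha^*s_\alpha s_\beta^*=p_{C(\alpha,\beta)}$ for all $\alpha,\beta\in\mathcal{L}_X$, where $s_\omega=s_\omega^*=1$ and, for $\alpha=\alpha(1)\cdots\alpha(n)$, $s_\alpha=s_{\alpha(1)}\cdots s_{\alpha(n)}$ and $s_\alpha^*=s_{\alpha(n)}^*\cdots s_{\alpha(1)}^*$. A ring $S$ is semiprime if whenever $I^2=0$ for an ideal $I$ of $S$, then $I=0$. *)

(* Defs.v *)
From HB Require Import structures.
From mathcomp Require Import all_boot all_order all_algebra.
From mathcomp Require Import generic_quotient.
From mathcomp Require Import boolp classical_sets.

Set Implicit Arguments.
Unset Strict Implicit.
Unset Printing Implicit Defensive.

Import GRing.Theory.
Local Open Scope quotient_scope.
Local Open Scope classical_set_scope.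
Local Open Scope ring_scope.

(** * Unital algebras given by generators and relations

The unital [R]-algebra [presented_alg rels] with generators [G] subject to the
relations [rels] is the set of algebra expressions over [G] modulo the least
congruence that contains [rels] and the axioms of unital (associative)
[R]-algebras.  Its universal property is [presented_alg_universal].  The
algebra may be zero, so it is a [pzRingType]; as [algType] only covers nonzero
algebras, a unital [R]-algebra is here a ring [B] with a ring morphism
[R -> B] of central image. *)

Inductive expr (R G : Type) : Type :=
| Gen of G
| Cst of R
| Add of expr R G & expr R G
| Opp of expr R G
| Mul of expr R G & expr R G.

Arguments Gen {R G}.
Arguments Cst {R G}.

HB.instance Definition _ (R G : Type) := gen_eqMixin (expr R G).
HB.instance Definition _ (R G : Type) := gen_choiceMixin (expr R G).

Section PresentedAlgebra.
Variables (R : comPzRingType) (G : Type).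
Variable rels : expr R G -> expr R G -> Prop.

Inductive expr_cong : expr R G -> expr R G -> Prop :=
| cong_rel t u : rels t u -> expr_cong t u
| cong_refl t : expr_cong t t
| cong_sym t u : expr_cong t u -> expr_cong u t
| cong_trans t u v : expr_cong t u -> expr_cong u v -> expr_cong t v
| cong_add t t' u u' :
    expr_cong t t' -> expr_cong u u' -> expr_cong (Add t u) (Add t' u')
| cong_opp t t' : expr_cong t t' -> expr_cong (Opp t) (Opp t')
| cong_mul t t' u u' :
    expr_cong t t' -> expr_cong u u' -> expr_cong (Mul t u) (Mul t' u')
| cong_addA t u v : expr_cong (Add t (Add u v)) (Add (Add t u) v)
| cong_addC t u : expr_cong (Add t u) (Add u t)
| cong_add0 t : expr_cong (Add (Cst 0) t) t
| cong_addN t : expr_cong (Add (Opp t) t) (Cst 0)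
| cong_mulA t u v : expr_cong (Mul t (Mul u v)) (Mul (Mul t u) v)
| cong_mul1l t : expr_cong (Mul (Cst 1) t) t
| cong_mul1r t : expr_cong (Mul t (Cst 1)) t
| cong_mulDl t u v : expr_cong (Mul (Add t u) v) (Add (Mul t v) (Mul u v))
| cong_mulDr t u v : expr_cong (Mul t (Add u v)) (Add (Mul t u) (Mul t v))
| cong_cstD a b : expr_cong (Cst (a + b)) (Add (Cst a) (Cst b))
| cong_cstM a b : expr_cong (Cst (a * b)) (Mul (Cst a) (Cst b))
| cong_cstC a t : expr_cong (Mul (Cst a) t) (Mul t (Cst a)).

Definition expr_congb : rel (expr R G) := fun t u => `[< expr_cong t u >].

Lemma expr_congb_equiv : equiv_class_of expr_congb.
Proof.
split=> [t | t u | u t v].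
- exact/asboolP/cong_refl.
- by apply/asboolP/asboolP; apply: cong_sym.
- by move=> /asboolP tu /asboolP uv; apply/asboolP; apply: cong_trans tu uv.
Qed.

Canonical expr_cong_equivRel := EquivRelPack expr_congb_equiv.

Definition presented_alg : Type := {eq_quot expr_cong_equivRel}.

HB.instance Definition _ := Choice.on presented_alg.

Definition pa_class (t : expr R G) : presented_alg :=
  \pi_({eq_quot expr_cong_equivRel})%qT t.
Definition pa_repr (x : presented_alg) : expr R G :=
  @repr _ {eq_quot expr_cong_equivRel} x.

Lemma pa_reprK : cancel pa_repr pa_class.
Proof. by move=> x; rewrite /pa_class /pa_repr reprK. Qed.

Lemma pa_classP t u : pa_class t = pa_class u <-> expr_cong t u.
Proof.
split=> [/eqquotP/asboolP // | tu].
by apply/eqquotP/asboolP.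
Qed.

Lemma pa_repr_class t : expr_cong (pa_repr (pa_class t)) t.
Proof. by apply/pa_classP; rewrite pa_reprK. Qed.

Definition pa_add (x y : presented_alg) := pa_class (Add (pa_repr x) (pa_repr y)).
Definition pa_opp (x : presented_alg) := pa_class (Opp (pa_repr x)).
Definition pa_mul (x y : presented_alg) := pa_class (Mul (pa_repr x) (pa_repr y)).

Lemma pa_addE t u : pa_add (pa_class t) (pa_class u) = pa_class (Add t u).
Proof. by apply/pa_classP/cong_add; apply: pa_repr_class. Qed.

Lemma pa_oppE t : pa_opp (pa_class t) = pa_class (Opp t).
Proof. by apply/pa_classP/cong_opp/pa_repr_class. Qed.

Lemma pa_mulE t u : pa_mul (pa_class t) (pa_class u) = pa_class (Mul t u).
Proof. by apply/pa_classP/cong_mul; apply: pa_repr_class. Qed.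

Lemma pa_ind (P : presented_alg -> Prop) :
  (forall t, P (pa_class t)) -> forall x, P x.
Proof. by move=> Pcl x; rewrite -(pa_reprK x). Qed.

Fact pa_addA : associative pa_add.
Proof.
elim/pa_ind=> t; elim/pa_ind=> u; elim/pa_ind=> v; rewrite !pa_addE.
exact/pa_classP/cong_addA.
Qed.

Fact pa_addC : commutative pa_add.
Proof.
by elim/pa_ind=> t; elim/pa_ind=> u; rewrite !pa_addE; apply/pa_classP/cong_addC.
Qed.

Fact pa_add0 : left_id (pa_class (Cst 0)) pa_add.
Proof. by elim/pa_ind=> t; rewrite pa_addE; apply/pa_classP/cong_add0. Qed.

Fact pa_addN : left_inverse (pa_class (Cst 0)) pa_opp pa_add.
Proof. by elim/pa_ind=> t; rewrite pa_oppE pa_addE; apply/pa_classP/cong_addN. Qed.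

HB.instance Definition _ :=
  GRing.isZmodule.Build presented_alg pa_addA pa_addC pa_add0 pa_addN.

Fact pa_mulA : associative pa_mul.
Proof.
elim/pa_ind=> t; elim/pa_ind=> u; elim/pa_ind=> v; rewrite !pa_mulE.
exact/pa_classP/cong_mulA.
Qed.

Fact pa_mul1l : left_id (pa_class (Cst 1)) pa_mul.
Proof. by elim/pa_ind=> t; rewrite pa_mulE; apply/pa_classP/cong_mul1l. Qed.

Fact pa_mul1r : right_id (pa_class (Cst 1)) pa_mul.
Proof. by elim/pa_ind=> t; rewrite pa_mulE; apply/pa_classP/cong_mul1r. Qed.

Fact pa_mulDl : left_distributive pa_mul pa_add.
Proof.
elim/pa_ind=> t; elim/pa_ind=> u; elim/pa_ind=> v.
by rewrite !(pa_addE, pa_mulE); apply/pa_classP/cong_mulDl.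
Qed.

Fact pa_mulDr : right_distributive pa_mul pa_add.
Proof.
elim/pa_ind=> t; elim/pa_ind=> u; elim/pa_ind=> v.
by rewrite !(pa_addE, pa_mulE); apply/pa_classP/cong_mulDr.
Qed.

HB.instance Definition _ := GRing.Zmodule_isPzRing.Build presented_alg
  pa_mulA pa_mul1l pa_mul1r pa_mulDl pa_mulDr.

Definition pa_cst (a : R) : presented_alg := pa_class (Cst a).
Definition pa_gen (g : G) : presented_alg := pa_class (Gen g).

Fact pa_cst_is_additive : zmod_morphism pa_cst.
Proof.
have cstD a b : pa_cst (a + b) = pa_cst a + pa_cst b.
  by rewrite [RHS]pa_addE; apply/pa_classP/cong_cstD.
by move=> a b; apply: (addIr (pa_cst b)); rewrite -cstD !subrK.
Qed.

Fact pa_cst_is_multiplicative : monoid_morphism pa_cst.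
Proof.
by split=> // a b; rewrite [RHS]pa_mulE; apply/pa_classP/cong_cstM.
Qed.

HB.instance Definition _ :=
  GRing.isZmodMorphism.Build R presented_alg pa_cst pa_cst_is_additive.
HB.instance Definition _ :=
  GRing.isMonoidMorphism.Build R presented_alg pa_cst pa_cst_is_multiplicative.

Lemma pa_cst_central a x : pa_cst a * x = x * pa_cst a.
Proof.
elim/pa_ind: x => t; rewrite [LHS]pa_mulE [RHS]pa_mulE.
exact/pa_classP/cong_cstC.
Qed.

End PresentedAlgebra.

Fixpoint expr_eval (R : Type) (G : Type) (B : pzRingType)
    (c : R -> B) (f : G -> B) (t : expr R G) : B :=
  match t with
  | Gen g => f g
  | Cst a => c a
  | Add t u => expr_eval c f t + expr_eval c f u
  | Opp t => - expr_eval c f t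
  | Mul t u => expr_eval c f t * expr_eval c f u
  end.

Lemma expr_eval_class (R : comPzRingType) (G : Type)
    (rels : expr R G -> expr R G -> Prop) (t : expr R G) :
  expr_eval (pa_cst rels) (pa_gen rels) t = pa_class rels t.
Proof.
elim: t => //= [t -> u -> | t -> | t -> u ->].
- exact: pa_addE.
- exact: pa_oppE.
- exact: pa_mulE.
Qed.

Lemma presented_alg_rel (R : comPzRingType) (G : Type)
    (rels : expr R G -> expr R G -> Prop) (t u : expr R G) : rels t u ->
  expr_eval (pa_cst rels) (pa_gen rels) t = expr_eval (pa_cst rels) (pa_gen rels) u.
Proof. by move=> tu; rewrite !expr_eval_class; apply/pa_classP/cong_rel. Qed.

Theorem presented_alg_universal (R : comPzRingType) (G : Type)
    (rels : expr R G -> expr R G -> Prop)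
    (B : pzRingType) (c : {rmorphism R -> B})
    (c_central : forall a x, c a * x = x * c a) (f : G -> B)
    (f_rel : forall t u, rels t u -> expr_eval c f t = expr_eval c f u) :
  exists h : {rmorphism presented_alg rels -> B},
    [/\ forall a, h (pa_cst rels a) = c a, forall g, h (pa_gen rels g) = f g
      & forall k : {rmorphism presented_alg rels -> B},
          (forall a, k (pa_cst rels a) = c a) ->
          (forall g, k (pa_gen rels g) = f g) -> k =1 h].
Proof.
pose ev := expr_eval c f.
have ev_cong t u : expr_cong rels t u -> ev t = ev u.
  rewrite /ev; elim=> //= {t u}.
  - by move=> t u v _ -> _ ->.
  - by move=> t t' u u' _ -> _ ->.
  - by move=> t t' _ ->.
  - by move=> t t' u u' _ -> _ ->.
  - by move=> t u v; rewrite addrA.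
  - by move=> t u; rewrite addrC.
  - by move=> t; rewrite rmorph0 add0r.
  - by move=> t; rewrite rmorph0 addNr.
  - by move=> t u v; rewrite mulrA.
  - by move=> t; rewrite rmorph1 mul1r.
  - by move=> t; rewrite rmorph1 mulr1.
  - by move=> t u v; rewrite mulrDl.
  - by move=> t u v; rewrite mulrDr.
  - by move=> a b; rewrite rmorphD.
  - by move=> a b; rewrite rmorphM.
pose h (x : presented_alg rels) : B := ev (pa_repr x).
have hE t : h (pa_class rels t) = ev t by apply/ev_cong/pa_repr_class.
have hB : zmod_morphism h.
  elim/pa_ind=> t; elim/pa_ind=> u.
  by rewrite -[_ - _]/(pa_add _ (pa_opp _)) pa_oppE pa_addE !hE.
have hM : monoid_morphism h.
  split; first by rewrite -[1]/(pa_class rels (Cst 1)) hE /ev /= rmorph1.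
  elim/pa_ind=> t; elim/pa_ind=> u.
  by rewrite -[_ * _]/(pa_mul _ _) pa_mulE !hE.
pose aM := GRing.isZmodMorphism.Build _ _ h hB.
pose mM := GRing.isMonoidMorphism.Build _ _ h hM.
pose hR : {rmorphism presented_alg rels -> B} := HB.pack h aM mM.
exists hR; split=> [a | g | k kc kg]; rewrite /= ?hE //.
elim/pa_ind=> t; rewrite hE /ev.
elim: t => /= [g | a | t <- u <- | t <- | t <- u <-].
- by rewrite -kg.
- by rewrite -kc.
- by rewrite -rmorphD -[_ + _]/(pa_add _ _) pa_addE.
- by rewrite -rmorphN -[- _]/(pa_opp _) pa_oppE.
- by rewrite -rmorphM -[_ * _]/(pa_mul _ _) pa_mulE.
Qed.

(** * Subshifts *)

Section Subshift.
Variable A : Type.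

Implicit Types (w : seq A) (x y : nat -> A) (X : set (nat -> A)).

Definition word_cat w x : nat -> A :=
  foldr (fun a y n => if n is m.+1 then y m else a) x w.

Definition occurs_in w x : Prop :=
  exists n : nat, [seq x i | i <- iota n (size w)] = w.

Definition subshift_of (F : set (seq A)) : set (nat -> A) :=
  [set x | forall w, F w -> ~ occurs_in w x].

Definition is_subshift X : Prop := exists F : set (seq A), X = subshift_of F.

(* The empty word is in the language even if [X] is empty. *)
Definition language X : set (seq A) :=
  [set w | w = [::] \/ exists2 x, X x & occurs_in w x].

Definition follower_set X (alpha beta : seq A) : set (nat -> A) :=
  [set y | exists x, [/\ y = word_cat beta x, X y & X (word_cat alpha x)]].

Inductive follower_algebra X : set (set (nat -> A)) :=
| fa_gen alpha beta : language X alpha -> language X beta ->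
    follower_algebra X (follower_set X alpha beta)
| fa_top : follower_algebra X X
| fa_compl D : follower_algebra X D -> follower_algebra X (X `\` D)
| fa_cap D E : follower_algebra X D -> follower_algebra X E ->
    follower_algebra X (D `&` E)
| fa_cup D E : follower_algebra X D -> follower_algebra X E ->
    follower_algebra X (D `|` E).

End Subshift.

(** * The unital subshift algebra *)

Section SubshiftAlgebra.
Variables (A : Type) (X : set (nat -> A)) (R : comPzRingType).

Inductive subshift_gen : Type :=
| PGen of set_type (follower_algebra X)
| SGen of A
| TGen of A. (* [TGen a] is the generator written s_a^* *)

Notation term := (expr R subshift_gen).

Definition p_ (D : set_type (follower_algebra X)) : term := Gen (PGen D).
Definition s_ (a : A) : term := Gen (SGen a).
Definition t_ (a : A) : term := Gen (TGen a).

Definition s_word (w : seq A) : term :=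
  foldr (fun a u => Mul (s_ a) u) (Cst 1) w.
Definition t_word (w : seq A) : term :=
  foldr (fun a u => Mul u (t_ a)) (Cst 1) w.

(* The index of a product, a sum or a word relation is given by an equation
   between subsets of [X], so that no membership proof enters the relations. *)
Inductive subshift_rel : term -> term -> Prop :=
| rel_top D : val D = X -> subshift_rel (p_ D) (Cst 1)
| rel_cap D E K : val K = val D `&` val E ->
    subshift_rel (p_ K) (Mul (p_ D) (p_ E))
| rel_cup D E K L : val K = val D `|` val E -> val L = val D `&` val E ->
    subshift_rel (p_ K) (Add (Add (p_ D) (p_ E)) (Opp (p_ L)))
| rel_empty D : val D = set0 -> subshift_rel (p_ D) (Cst 0)
| rel_sts a : subshift_rel (Mul (Mul (s_ a) (t_ a)) (s_ a)) (s_ a)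
| rel_tst a : subshift_rel (Mul (Mul (t_ a) (s_ a)) (t_ a)) (t_ a)
| rel_word alpha beta D : language X alpha -> language X beta ->
    val D = follower_set X alpha beta ->
    subshift_rel
      (Mul (Mul (Mul (s_word beta) (t_word alpha)) (s_word alpha))
           (t_word beta))
      (p_ D).

End SubshiftAlgebra.

Definition unital_subshift_alg (R : comPzRingType) (A : Type)
    (X : set (nat -> A)) : pzRingType :=
  presented_alg (@subshift_rel A X R).

(** * Semiprime rings *)

Definition is_ideal (S : pzRingType) (I : set S) : Prop :=
  [/\ I 0, forall x y, I x -> I y -> I (x - y)
    & forall a x, I x -> I (a * x) /\ I (x * a)].

Definition ideal_mul (S : pzRingType) (I J : set S) : set S :=
  [set z | exists (n : nat) (x y : 'I_n -> S),
     [/\ forall i, I (x i), forall i, J (y i) & z = \sum_(i < n) x i * y i]].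

Definition semiprime (S : pzRingType) : Prop :=
  forall I : set S, is_ideal I -> ideal_mul I I = [set 0] -> I = [set 0].

(* Main.v *)
Require Import Defs.
From mathcomp Require Import all_boot all_order all_algebra.
From mathcomp Require Import boolp classical_sets.
From mathcomp Require Import zify ring.

(** The letters that occur in [X] generate a subalgebra [C] spanned by the
  elements [s_alpha p_D t_beta], which is an algebra of functions on the tail
  equivalence groupoid of [X], graded by the length difference.  A letter [a]
  that does not occur in [X] is only subject to [s_a t_a s_a = s_a] and
  [t_a s_a t_a = t_a], so the whole algebra is the coproduct of [C] with the
  algebras generated by these pairs, and it is not enough to understand [C].

  Factor formally [s_a = i_a p_a] and [t_a = j_a q_a], so that the relations
  read [p_a j_a = 1] and [q_a i_a = 1].  Filter the algebra by the number of
  factors [i_a p_a], [i_a q_a], [j_a p_a], [j_a q_a], and let it act on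
  functions on alternating sequences of groupoid arrows and such factors.  An
  element of degree [n] whose image of the vacuum vector vanishes on the
  sequences of length [n] has degree less than [n]; so a nonzero [x] of
  minimal degree [n] is detected by a sequence of length [n].

  If some [a] does not occur in [X], the value of [x w s_a w' x] at the
  concatenation of two such sequences is the product of the two values, for
  suitable [w], [w'] making the arrows at the junction non-units.  If all
  letters occur, isolate by [p_D] the range of a single arrow of top degree
  in [x] and bring it back to its source: the result acts as a nonzero
  Laurent polynomial.  In both cases [x w x <> 0] for some [w]. *)

Set Implicit Arguments.
Unset Strict Implicit.
Unset Printing Implicit Defensive.

Import Order.TTheory GRing.Theory Num.Theory.
Local Open Scope classical_set_scope.
Local Open Scope ring_scope.

(** * Words and subshifts *)

Section Words.
Variable A : Type.
Implicit Types (v w : seq A) (x y : nat -> A).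

Definition shift x : nat -> A := fun n => x n.+1.

Lemma word_cat_cat v w x : word_cat (v ++ w) x = word_cat v (word_cat w x).
Proof. by rewrite /word_cat foldr_cat. Qed.

Lemma word_cat_head_shift x : word_cat [:: x 0%N] (shift x) = x.
Proof. by apply/funext => -[]. Qed.

Lemma word_cat_cons_inj a b v w x y :
  word_cat (a :: v) x = word_cat (b :: w) y -> a = b /\ word_cat v x = word_cat w y.
Proof.
move=> e; split; first exact: (congr1 (fun f => f 0%N) e).
by apply/funext => n; exact: (congr1 (fun f => f n.+1) e).
Qed.

Lemma word_cat_prefix v w x y : (size v <= size w)%N ->
  word_cat v x = word_cat w y -> exists2 u, w = v ++ u & x = word_cat u y.
Proof.
elim: v w => [|a v IH] [|b w] //=; first by move=> _ ->; exists [::].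
  by move=> _ ->; exists (b :: w).
rewrite ltnS => vw /word_cat_cons_inj[-> /(IH _ vw)[u -> ->]].
by exists u.
Qed.

Lemma word_cat_inj w : injective (word_cat w).
Proof. by move=> x y; elim: w => //= a w IH /(@word_cat_cons_inj a a)[_ /IH]. Qed.

Lemma word_cat_mkseq n x : word_cat (mkseq x n) (iter n shift x) = x.
Proof.
elim: n x => // n IH x; rewrite -[RHS]word_cat_head_shift -[in RHS](IH (shift x)).
by rewrite iterSr /mkseq /= (iotaDl 1 0) -map_comp.
Qed.

Lemma word_cat_nth w x y n : (n < size w)%N -> word_cat w x n = word_cat w y n.
Proof. by elim: w n => [|a w IH] [|n] //= /IH. Qed.

Lemma occurs_in_word_cat v w x : occurs_in v x -> occurs_in v (word_cat w x).
Proof.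
move=> [n <-]; exists (n + size w)%N; rewrite size_map size_iota.
elim: w => [|a w IH] /=; first by rewrite addn0.
rewrite -IH addnS -addn1 [in LHS]addnC iotaDl -map_comp.
by apply: eq_map.
Qed.

Lemma occurs_inP w x : occurs_in w x <->
  exists n, iter n shift x = word_cat w (iter (size w + n) shift x).
Proof.
have iterE m n y : iter n shift y m = y (m + n)%N.
  by elim: n m => [|n IH] m; rewrite ?addn0 //= /shift IH addSnnS.
split=> -[n xw]; exists n.
  apply/funext => m; rewrite iterE.
  elim: w n m xw => [|a w IH] n m; first by rewrite /= iterE.
  move=> /= [xn xw]; case: m => [|m] /=; first by rewrite add0n xn.
  by rewrite addSnnS (IH n.+1) // addnS.
elim: w n xw => [|a w IH] n //= xw.
have [xn xw'] : x n = a /\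
    iter n.+1 shift x = word_cat w (iter (size w + n.+1) shift x).
  split; first by have := congr1 (fun f => f 0%N) xw; rewrite /= iterE.
  apply/funext => m; have := congr1 (fun f => f m.+1) xw.
  by rewrite addnS.
by rewrite xn (IH n.+1).
Qed.

End Words.
Arguments shift {A}.

Section Subshift.
Variables (A : Type) (X : set (nat -> A)).
Hypothesis X_subshift : is_subshift X.
Implicit Types (v w : seq A) (x y : nat -> A) (D E : set (nat -> A)).

Lemma subshift_tail w x : X (word_cat w x) -> X x.
Proof.
have [F ->] := X_subshift => Xwx v Fv vx; apply: (Xwx v Fv).
exact: occurs_in_word_cat.
Qed.

Lemma subshift_shift x : X x -> X (shift x).
Proof. by rewrite -{1}(word_cat_head_shift x) => /subshift_tail. Qed.

Lemma language_word_cat w x : X (word_cat w x) -> language X w.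
Proof.
move=> Xwx; right; exists (word_cat w x) => //; apply/occurs_inP; exists 0%N => /=.
rewrite addn0; congr word_cat; elim: w {Xwx} => // a w {1}->.
by rewrite [size _]/= iterSr.
Qed.

(** An occurrence at position [n] is brought to the front by dropping [n] letters, which does not
    leave [X]. The empty word is a separate case because [X] may be empty. *)
Lemma languageP w : language X w -> w = [::] \/ exists x, X (word_cat w x).
Proof.
case=> [-> | [x Xx /occurs_inP[n xn]]]; [by left | right].
exists (iter (size w + n) shift x); rewrite -xn.
by elim: n {xn} => //= n; apply: subshift_shift.
Qed.

Lemma language_behead a w : language X (a :: w) -> language X w.
Proof.
case/languageP=> // -[x /(@subshift_tail [:: a])].
exact: language_word_cat.
Qed.

Lemma language_head a w : language X (a :: w) -> language X [:: a].
Proof.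
by case/languageP=> // -[x] /(@language_word_cat [:: a] (word_cat w x)).
Qed.

Local Notation U := (follower_algebra X).

Lemma follower_algebra_sub D : U D -> D `<=` X.
Proof.
elim=> [v w _ _ y [x []] //| // | E _ _ y [] //| E K _ sE _ _ y [/sE] //|].
by move=> E K _ sE _ sK y [/sE | /sK].
Qed.

Lemma follower_algebra0 : U set0.
Proof. by rewrite -(setDv X); do 2?[constructor]. Qed.

Lemma follower_algebraD D E : U D -> U E -> U (D `\` E).
Proof.
move=> UD UE; suff -> : D `\` E = D `&` (X `\` E) by do 2?[constructor].
apply/seteqP; split=> y [Dy] => [nEy | [_ nEy]]; last by [].
by split=> //; split=> //; apply: follower_algebra_sub Dy.
Qed.

(** Unlike membership in the language, this is stable under concatenation. Monomials may therefore
    use words outside the language; such monomials are zero by [mon0]. *)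
Definition letters_in w : Prop :=
  foldr (fun a P => language X [:: a] /\ P) True w.

Lemma letters_in_cat v w : letters_in (v ++ w) <-> letters_in v /\ letters_in w.
Proof. by elim: v => /= [|a v ->]; tauto. Qed.

Lemma language_letters_in w : language X w -> letters_in w.
Proof.
elim: w => //= a w IH aw; split; first exact: language_head aw.
exact/IH/language_behead/aw.
Qed.

Definition preimage_word w E : set (nat -> A) := [set z | E (word_cat w z)].
Definition image_word w D : set (nat -> A) :=
  [set y | X y /\ exists2 z, D z & y = word_cat w z].

Lemma image_word_preimage w D E :
  image_word w (E `&` preimage_word w D) = image_word w E `&` (X `&` D).
Proof.
apply/seteqP; split=> y.
  by case=> Xy [z [Ez Dz] yz]; rewrite yz; repeat split=> //; rewrite -?yz//; exists z.
case=> -[Xy [z Ez yz]] [_ Dy]; split=> //; exists z => //; split=> //.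
by rewrite /preimage_word /= -yz.
Qed.

End Subshift.

(** * The path module *)

Section Grouping.
Variables (V : nmodType) (T K : Type) (f : T -> V) (key : T -> K) (Q : V -> Prop).
Hypotheses (Q0 : Q 0) (QD : forall u v, Q u -> Q v -> Q (u + v)).

(** Induction on the length: the terms that share the key of the head are split off, and the list of
    the others is shorter and still satisfies the hypothesis. *)
Lemma sum_by_key (l : seq T) :
  (forall k, Q (\sum_(q <- l | `[< key q = k >]) f q)) -> Q (\sum_(q <- l) f q).
Proof.
have [n] := ubnP (size l); elim: n l => // n IH [|q l] /=; first by rewrite big_nil.
rewrite ltnS => ln Ql; rewrite (bigID (fun r => `[< key r = key q >])) /=.
apply: QD => //; rewrite big_cons asboolT //= -big_filter.
apply: IH => [|k]; first by rewrite size_filter (leq_ltn_trans (count_size _ _)) .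
rewrite big_filter_cond; have [-> | kq] := EM (k = key q).
  by rewrite big1 // => r /andP[/negP].
have := Ql k; rewrite big_cons asboolF; last by move=> e; apply: kq.
congr Q; apply: eq_bigl => r; apply/idP/andP => [/asboolP rk | []] //.
by split; last exact/asboolP; apply/asboolPn; rewrite rk.
Qed.

End Grouping.

Section PathOperators.
Variables (A : Type) (X : set (nat -> A)) (R : comPzRingType).
Hypothesis X_subshift : is_subshift X.

Definition xpoint : Type := set_type X.
(** All triples are allowed, also those outside the tail equivalence groupoid; [p_op], [s_op] and
    [t_op] only involve the first two components of the first arrow. *)
Definition arrow : Type := (xpoint * int * xpoint)%type.
Definition symbol : Type := (A * bool * bool)%type.
Definition gpath : Type := (arrow * seq (symbol * arrow))%type.

Implicit Types (y z : xpoint) (k : int) (g : arrow) (L : seq (symbol * arrow))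
  (F : gpath -> R) (e : symbol).

Definition pt x (Xx : X x) : xpoint := exist _ x (mem_set Xx).

Lemma point_sub y : X (val y). Proof. exact: set_valP. Qed.

Definition tail y : xpoint := pt (subshift_shift X_subshift (point_sub y)).

Definition is_unit g : Prop := g.1.1 = g.2 /\ g.1.2 = 0.

Definition p_op (D : set (nat -> A)) F : gpath -> R :=
  fun P => if `[< D (val P.1.1.1) >] then F P else 0.

(** Left convolution with the indicator function of the arrows [(y, 1, tail y)] for [y] starting
    with [a]; [t_op] uses the inverse arrows. *)
Definition s_op (a : A) F : gpath -> R := fun P =>
  let: (y, k, z, L) := P in
  if `[< val y 0%N = a >] then F (tail y, k - 1, z, L) else 0.

Definition t_op (a : A) F : gpath -> R := fun P =>
  let: (y, k, z, L) := P in
  if pselect (X (word_cat [:: a] (val y))) is left Xay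
  then F (pt Xay, k + 1, z, L) else 0.

Definition word_s_op (w : seq A) F : gpath -> R := foldr s_op F w.
Definition word_t_op (w : seq A) F : gpath -> R := foldl (fun G a => t_op a G) F w.

Lemma word_s_opE w F (y u : xpoint) k z L : val y = word_cat w (val u) ->
  word_s_op w F (y, k, z, L) = F (u, k - (size w)%:Z, z, L).
Proof.
elim: w y k => [|a w IH] y k /=; first by move=> /val_inj ->; rewrite subr0.
move=> yu; rewrite /s_op asboolT; last by rewrite /= yu.
rewrite IH; first by congr (F (_, _, _, _)); rewrite -addrA -opprD -PoszD add1n.
by rewrite /= yu.
Qed.

Lemma word_s_op0 w F (y : xpoint) k z L :
  (forall u : xpoint, val y <> word_cat w (val u)) ->
  word_s_op w F (y, k, z, L) = 0.
Proof.
elim: w y k => [|a w IH] y k /=; first by move=> /(_ y).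
move=> yu; rewrite /s_op; case: asboolP => // ya; apply: IH => u /= yu'.
by apply: (yu u); rewrite -ya -[LHS]word_cat_head_shift yu'.
Qed.

Lemma word_t_opE w F (y u : xpoint) k z L : val u = word_cat w (val y) ->
  word_t_op w F (y, k, z, L) = F (u, k + (size w)%:Z, z, L).
Proof.
elim: w u F => [|a w IH] u F /=; first by move=> /val_inj ->; rewrite addr0.
move=> uy.
have Xawy : X (word_cat (a :: w) (val y)) by have := point_sub u; rewrite /= uy.
have Xwy : X (word_cat w (val y)) := @subshift_tail _ _ X_subshift [:: a] _ Xawy.
rewrite (IH (pt Xwy)) // /t_op; case: pselect => [Xay | []] //.
congr (F (_, _, _, _)); first by apply: val_inj; rewrite /= uy.
by rewrite -addrA -PoszD addn1.
Qed.

Lemma word_t_op0 w F (y : xpoint) k z L :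
  ~ X (word_cat w (val y)) -> word_t_op w F (y, k, z, L) = 0.
Proof.
elim: w F => [|a w IH] F /=; first by move=> []; apply: point_sub.
move=> nX; have [Xwy | nXwy] := EM (X (word_cat w (val y))); last exact: IH.
rewrite (@word_t_opE _ _ _ (pt Xwy)) // /t_op.
by case: pselect.
Qed.

(** Both sides vanish unless [y] is [w] followed by a point [u]. Then the words lead from [y] to
    [u], to [v] followed by [u], and back; the degree shifts cancel, and the value survives exactly
    if [v] followed by [u] lies in [X]. *)
Lemma word_op v w F :
  word_s_op w (word_t_op v (word_s_op v (word_t_op w F))) =
  p_op (follower_set X v w) F.
Proof.
apply/funext => -[[[y k] z] L]; rewrite /p_op /=.
have [[u yu] | nu] := EM (exists u : xpoint, val y = word_cat w (val u)); last first.
  rewrite asboolF => [|[x [yx Xy _]]].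
    by apply: word_s_op0 => u yu; apply: nu; exists u.
  have Xx : X x by apply: (@subshift_tail _ _ X_subshift w); rewrite -yx.
  by apply: nu; exists (pt Xx).
rewrite (word_s_opE _ _ _ _ yu); have [Xvu | nXvu] := EM (X (word_cat v (val u))).
  rewrite (@word_t_opE _ _ _ (pt Xvu)) // (@word_s_opE _ _ _ u) //.
  rewrite (word_t_opE _ _ _ _ yu) addrK subrK asboolT //.
  by exists (val u); split=> //; exact: point_sub.
rewrite word_t_op0 // asboolF // => -[x [yx _ Xvx]]; apply: nXvu.
by move: yx; rewrite [LHS]yu => /word_cat_inj ->.
Qed.

Definition starts (i : A * bool) L : Prop :=
  if L is (e, _) :: _ then e.1 = i else False.

Variable x0 : xpoint.
Definition base : arrow := (x0, 0, x0).

(* [symbol_op (a, b, c) F] is [1 (x) y (x) (x' F)], with [y] in [{i_a, j_a}] and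
   [x'] in [{p_a, q_a}] given by [b] and [c].  If [y'] is the symbol with
   [x' y' = 1], then [x'] maps [f (x) y' (x) t], for a function [f] on arrows,
   to the scalar [f base] times [t], plus [f - (f base) 1] prefixed by [x']
   and followed by [y' (x) t]. *)
Definition symbol_op e F : gpath -> R := fun P =>
  if P.2 is (e', g) :: L then
    if `[< is_unit P.1 /\ e'.1 = e.1 >] then
      F (base, ((e.1.1, ~~ e.2, e'.2), g) :: L) +
      (if e'.2 == e.2 then
         F (g, L) -
         (if `[< is_unit g /\ starts (e.1.1, ~~ e.2) L >] then F (base, L) else 0)
       else 0)
    else 0
  else 0.

Lemma base_unit : is_unit base. Proof. by []. Qed.

(** The relation [x' y' = 1] on paths. An image of the inner operator is constant on unit arrows,
    zero at other arrows and zero on paths that do not start with [y']. On such a function the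
    correction of the outer operator cancels, and only the coefficient of [y'] is left. *)
Lemma symbol_opM a b c d F :
  symbol_op (a, b, c) (symbol_op (a, ~~ c, d) F) = symbol_op (a, b, d) F.
Proof.
set G := symbol_op (a, ~~ c, d) F; apply/funext => -[g [|[[[a1 b1] c1] g1] L]] //.
have G_base L' : G (base, L') = if `[< starts (a, ~~ c) L' >] then G (base, L') else 0.
  case: asboolP => //; case: L' => [|[e' g'] L'] //= ne.
  by rewrite /G /symbol_op /= asboolF // => -[_ /ne].
have G_unit g' L' : G (g', L') = if `[< is_unit g' >] then G (base, L') else 0.
  case: L' => [|[e' g''] L'] /=; first by rewrite /G /symbol_op /= if_same.
  case: asboolP => [ug | nug]; last by rewrite /G /symbol_op /= asboolF // => -[].
  rewrite /G /symbol_op /=; congr (if _ then _ else _).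
  by apply: asbool_equiv_eq; split=> -[_ ->]; split.
rewrite {1}/symbol_op /= [G (g1, L)]G_unit.
have -> : (if `[< is_unit g1 >] then G (base, L) else 0) -
    (if `[< is_unit g1 /\ starts (a, ~~ c) L >] then G (base, L) else 0) = 0.
  rewrite [X in if `[< is_unit g1 >] then X else _]G_base asbool_and.
  by case: asboolP; case: asboolP; rewrite ?subrr.
rewrite if_same addr0 /symbol_op /=; case: asboolP => // _.
by rewrite /G /symbol_op /= (asboolT (conj base_unit erefl)).
Qed.

(** The tensor [1 (x) c]: the identity of the groupoid algebra is the indicator function of the unit
    arrows. *)
Definition at_units (c : seq (symbol * arrow) -> R) : gpath -> R :=
  fun P => if `[< is_unit P.1 >] then c P.2 else 0.

Definition vacuum : gpath -> R := at_units (fun L => (size L == 0%N)%:R).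

Definition bounded (n : nat) F : Prop :=
  forall g L, (n < size L)%N -> F (g, L) = 0.

Lemma vacuum_bounded : bounded 0 vacuum.
Proof. by move=> g [|q L] // _; rewrite /vacuum /at_units /= if_same. Qed.

Lemma symbol_op_units e F :
  symbol_op e F = at_units (fun L => symbol_op e F (base, L)).
Proof.
apply/funext => -[g [|[e' g'] L]]; rewrite /at_units /symbol_op /= ?if_same //.
have [ug | nug] := EM (is_unit g).
  rewrite (asboolT ug); congr (if _ then _ else _).
  by apply: asbool_equiv_eq; split=> -[_ ->]; split.
by rewrite (asboolF nug) asboolF // => -[].
Qed.

Lemma symbol_op_bounded n e F : bounded n F -> bounded n.+1 (symbol_op e F).
Proof.
move=> Fn g [|[e' g'] L] //= nL; rewrite /symbol_op /= (Fn base (_ :: L)) ?(ltnW nL) //.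
by rewrite !(Fn _ L) // !(if_same, subr0, addr0).
Qed.

(** The scalar term of [symbol_op] evaluates [F] on a path with [n + 1] symbols, where it is zero;
    only the prefixing by [e] and its correction remain. *)
Lemma symbol_op_top n e F e' g g' L : bounded n F -> size L = n ->
  symbol_op e F (g, (e', g') :: L) =
  if `[< is_unit g /\ e' = e >] then
    F (g', L) -
    (if `[< is_unit g' /\ starts (e.1.1, ~~ e.2) L >] then F (base, L) else 0)
  else 0.
Proof.
move=> Fn sL; rewrite /symbol_op /= (Fn base (_ :: L)) /= ?sL // add0r.
case: e e' => [i b] [i' b'] /=.
have [[ug <-] | ne] := EM (is_unit g /\ i' = i); last first.
  by rewrite !asboolF // => -[ug [e _]]; apply: ne; split.
rewrite (asboolT (conj ug erefl)); case: eqVneq => [-> | nb].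
  by rewrite (asboolT (conj ug erefl)).
by rewrite asboolF // => -[_ [/eqP]]; rewrite (negPf nb).
Qed.

Definition linear_op (T : (gpath -> R) -> gpath -> R) : Prop :=
  forall (r : R) F G, T (fun P => r * F P + G P) = fun P => r * T F P + T G P.

Lemma p_op_linear D : linear_op (p_op D).
Proof.
by move=> r F G; apply/funext => P; rewrite /p_op; case: asboolP; rewrite ?mulr0 ?addr0.
Qed.

Lemma s_op_linear a : linear_op (s_op a).
Proof.
move=> r F G; apply/funext => -[[[y k] z] L]; rewrite /s_op.
by case: asboolP; rewrite ?mulr0 ?addr0.
Qed.

Lemma t_op_linear a : linear_op (t_op a).
Proof.
move=> r F G; apply/funext => -[[[y k] z] L]; rewrite /t_op.
by case: pselect; rewrite ?mulr0 ?addr0.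
Qed.

Lemma symbol_op_linear e : linear_op (symbol_op e).
Proof.
move=> r F G; apply/funext => -[g [|[e' g'] L]]; rewrite /symbol_op /= ?mulr0 ?addr0 //.
case: asboolP => _; last by rewrite mulr0 addr0.
case: eqP => _; last by rewrite !addr0.
by case: asboolP => _; ring.
Qed.

End PathOperators.

(** * Monomials in the letters of the language *)

Section Relations.
Variables (A : Type) (X : set (nat -> A)).
Hypothesis X_subshift : is_subshift X.
Implicit Types (a b : A) (v w : seq A) (x y : nat -> A) (D E : set (nat -> A)).

Local Notation U := (follower_algebra X).

Variables (B : pzRingType) (gen_p : set (nat -> A) -> B) (gen_s gen_t : A -> B).

Definition word_s w : B := foldr (fun a u => gen_s a * u) 1 w.
Definition word_t w : B := foldr (fun a u => u * gen_t a) 1 w.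

Hypothesis gen_pX : gen_p X = 1.
Hypothesis gen_p0 : gen_p set0 = 0.
Hypothesis gen_pI : forall D E, U D -> U E -> gen_p (D `&` E) = gen_p D * gen_p E.
Hypothesis gen_pU : forall D E, U D -> U E ->
  gen_p (D `|` E) = gen_p D + gen_p E - gen_p (D `&` E).
Hypothesis gen_sts : forall a, gen_s a * gen_t a * gen_s a = gen_s a.
Hypothesis gen_tst : forall a, gen_t a * gen_s a * gen_t a = gen_t a.
Hypothesis word_rel : forall v w, language X v -> language X w ->
  word_s w * word_t v * word_s v * word_t w = gen_p (follower_set X v w).

Lemma gen_p_split D E : U D -> U E ->
  gen_p D = gen_p (D `&` E) + gen_p (D `\` E).
Proof.
move=> UD UE; have UDE := follower_algebraD UD UE.
rewrite -{1}(setUIDK D E) gen_pU //; last exact: fa_cap.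
rewrite (_ : D `&` E `&` (D `\` E) = set0) ?gen_p0 ?subr0 //.
by apply/seteqP; split=> // y [[_ Ey] [_ /(_ Ey)]].
Qed.

Lemma gen_pC D : U D -> gen_p (X `\` D) = 1 - gen_p D.
Proof.
move=> UD; rewrite -gen_pX (gen_p_split (fa_top X) UD).
have -> : X `&` D = D by rewrite setIC setIidl //; exact: follower_algebra_sub.
by rewrite addrAC subrr add0r.
Qed.

Lemma gen_p_comm D E : U D -> U E -> gen_p D * gen_p E = gen_p E * gen_p D.
Proof. by move=> UD UE; rewrite -!gen_pI // setIC. Qed.

Lemma word_s_cat v w : word_s (v ++ w) = word_s v * word_s w.
Proof. by elim: v => /= [|a v ->]; rewrite ?mul1r ?mulrA. Qed.

Lemma word_t_cat v w : word_t (v ++ w) = word_t w * word_t v.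
Proof. by elim: v => /= [|a v ->]; rewrite ?mulr1 ?mulrA. Qed.

Lemma language0 : language X [::]. Proof. by left. Qed.
Hint Resolve language0 : core.

(** * Commutation of one letter of the language with the projections *)

Section Letter.
Variables (b : A) (Lb : language X [:: b]).

Let dom := follower_set X [:: b] [::].
Let ran := follower_set X [::] [:: b].

Lemma follower_set_dom : dom = preimage_word [:: b] X.
Proof.
apply/seteqP; split=> [y [x [-> _]] // | y Xby].
by exists y; split=> //; exact: (@subshift_tail _ _ X_subshift [:: b] _ Xby).
Qed.

Lemma follower_set_ran : ran = image_word X [:: b] X.
Proof.
apply/seteqP; split=> [y [x [yx Xy Xx]] | y [Xy [z Xz yz]]]; last by exists z.
by split=> //; exists x.
Qed.

Lemma gen_ts : gen_t b * gen_s b = gen_p dom.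
Proof. by rewrite -word_rel //= mul1r !mulr1 mul1r. Qed.

Lemma gen_st : gen_s b * gen_t b = gen_p ran.
Proof. by rewrite -word_rel //= !mulr1 mul1r. Qed.

Let U_dom : U dom. Proof. exact: fa_gen. Qed.
Let U_ran : U ran. Proof. exact: fa_gen. Qed.

(** The partial isometry relations insert [s_b t_b] and [s_c t_c] in the middle; these are
    projections onto disjoint cylinders. *)
Lemma gen_ts_neq c : language X [:: c] -> b <> c -> gen_t b * gen_s c = 0.
Proof.
move=> Lc bc; rewrite -(gen_tst b) -(gen_sts c).
have -> : gen_t b * gen_s b * gen_t b * (gen_s c * gen_t c * gen_s c) =
  gen_t b * (gen_s b * gen_t b * (gen_s c * gen_t c)) * gen_s c.
  by rewrite !mulrA.
have := word_rel language0 Lc; rewrite gen_st /= !mulr1 mul1r => ->.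
rewrite -gen_pI //; last exact: fa_gen.
rewrite (_ : ran `&` _ = set0) ?gen_p0 ?mulr0 ?mul0r //.
apply/seteqP; split=> // y [[u [-> _ _]] [v [uv _ _]]].
by have [] := word_cat_cons_inj uv.
Qed.

(** Both claims are proved together by induction on the membership of [E] in the Boolean algebra.
    For intersections, the range projection [s_b t_b] is moved past [gen_p E], with which it
    commutes, and is absorbed by [s_b]. *)
Lemma preimage_letter E : U E ->
  U (preimage_word [:: b] E) /\
  gen_t b * gen_p E * gen_s b = gen_p (preimage_word [:: b] E).
Proof.
elim=> {E} [v w Lv Lw | | D UD [UbD ebD] | D E UD [UbD ebD] UE [UbE ebE]
  | D E UD [UbD ebD] UE [UbE ebE]].
- rewrite -word_rel //; case: w Lw => [_ | c w Lcw].
    rewrite /= mulr1 mul1r mulrA -mulrA.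
    have -> : gen_t b * word_t v = word_t (v ++ [:: b]).
      by rewrite word_t_cat /= mul1r.
    have -> : word_s v * gen_s b = word_s (v ++ [:: b]).
      by rewrite word_s_cat /= mulr1.
    have [Lvb | nLvb] := EM (language X (v ++ [:: b])).
      have -> : preimage_word [:: b] (follower_set X v [::]) =
          follower_set X (v ++ [:: b]) [::].
        apply/seteqP; split=> y.
          case=> _ [/= <- Xby Xvy]; exists y; split=> //; last by rewrite word_cat_cat.
          exact: (@subshift_tail _ _ X_subshift [:: b] _ Xby).
        case=> z [-> _]; rewrite word_cat_cat => Xvbz.
        exists (word_cat [:: b] z); split=> //.
        exact: (subshift_tail X_subshift Xvbz).
      split; first exact: fa_gen.
      by rewrite -word_rel //= mulr1 mul1r.
    (* No relation is available for a word outside the language. Instead [gen_sts] inserts the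
       projection onto [ran], which is disjoint from the follower set of [v]. *)
    have e0 y : ~ X (word_cat v (word_cat [:: b] y)).
      by rewrite -word_cat_cat => /language_word_cat.
    have -> : preimage_word [:: b] (follower_set X v [::]) = set0.
      by apply/seteqP; split=> // y [_ [/= <- _ /e0]].
    split; first exact: follower_algebra0.
    rewrite gen_p0 word_t_cat word_s_cat /= mul1r mulr1.
    transitivity (gen_t b * (word_t v * word_s v * (gen_s b * gen_t b)) * gen_s b).
      by rewrite -{1}(gen_sts b) !mulrA.
    have := word_rel Lv language0; rewrite /= mul1r mulr1 gen_st => ->.
    rewrite -gen_pI //; last exact: fa_gen.
    rewrite (_ : _ `&` ran = set0) ?gen_p0 ?mulr0 ?mul0r //.
    by apply/seteqP; split=> // y [[z [-> _ Xvz]] [x [zx _ _]]];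
      move: Xvz; move: zx => /= -> /e0.
  have Lw := language_behead X_subshift Lcw.
  have Lc := language_head X_subshift Lcw.
  have [bc | bc] := EM (b = c); last first.
    rewrite (_ : preimage_word _ _ = set0); last first.
      apply/seteqP; split=> // y [x [e _ _]].
      by have [] := word_cat_cons_inj e.
    split; first exact: follower_algebra0.
    by rewrite gen_p0 /= !mulrA gen_ts_neq // !mul0r.
  rewrite -{c}bc in Lcw Lc *.
  (* The two copies of [dom] match the factors [t_b s_b] at the two ends of the product. *)
  have -> : preimage_word [:: b] (follower_set X v (b :: w)) =
      dom `&` follower_set X v w `&` dom.
    apply/seteqP; split=> y.
      case=> x [e Xby Xvx]; have [_ yx] := word_cat_cons_inj e.
      have Xy := @subshift_tail _ _ X_subshift [:: b] _ Xby.
      by split; [split; [exists y | exists x] | exists y].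
    case=> -[[z [-> _ Xbz]] [x [zx _ Xvx]]] _; exists x; split=> //.
    by move: zx => /= ->.
  have Uvw : U (follower_set X v w) by exact: fa_gen.
  split; first exact: (fa_cap (fa_cap U_dom Uvw) U_dom).
  rewrite (gen_pI (fa_cap U_dom Uvw) U_dom) (gen_pI U_dom Uvw).
  by rewrite -(word_rel Lv Lw) -gen_ts /= !mulrA.
- split; last by rewrite gen_pX mulr1 gen_ts follower_set_dom.
  by rewrite -follower_set_dom.
- have -> : preimage_word [:: b] (X `\` D) = dom `\` preimage_word [:: b] D.
    by rewrite follower_set_dom.
  split; first exact: follower_algebraD.
  rewrite gen_pC // mulrBr mulrBl mulr1 ebD gen_ts (gen_p_split U_dom UbD).
  have -> : dom `&` preimage_word [:: b] D = preimage_word [:: b] D.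
    rewrite setIC setIidl // follower_set_dom => y; exact: (follower_algebra_sub UD).
  by rewrite addrAC subrr add0r.
- split; first exact: (fa_cap UbD UbE).
  rewrite [RHS](gen_pI UbD UbE) -ebD -ebE gen_pI //.
  rewrite -!mulrA (mulrA (gen_s b)) gen_st (mulrA (gen_p ran)) gen_p_comm //.
  by rewrite -gen_st -!mulrA (mulrA (gen_s b)) gen_sts.
- split; first exact: (fa_cup UbD UbE).
  have UI := fa_cap UbD UbE.
  rewrite [RHS](gen_pU UbD UbE) -ebD -ebE gen_pU // mulrBr mulrDr mulrBl mulrDl.
  congr (_ - _); rewrite gen_pI // (gen_pI UbD UbE) -ebD -ebE.
  rewrite -!mulrA (mulrA (gen_s b)) gen_st (mulrA (gen_p ran)) gen_p_comm //.
  by rewrite -gen_st -!mulrA (mulrA (gen_s b)) gen_sts.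
Qed.

Lemma gen_ps E : U E -> gen_p E * gen_s b = gen_s b * gen_p (preimage_word [:: b] E).
Proof.
move=> UE; have [_ <-] := preimage_letter UE.
rewrite !mulrA gen_st -gen_p_comm // -gen_st -mulrA.
by rewrite gen_sts.
Qed.

Lemma gen_tp E : U E -> gen_t b * gen_p E = gen_p (preimage_word [:: b] E) * gen_t b.
Proof.
move=> UE; have [_ <-] := preimage_letter UE.
rewrite -!mulrA gen_st gen_p_comm // -gen_st !mulrA.
by rewrite gen_tst.
Qed.

(** Dual to [preimage_letter], by the same induction with the domain projection [t_b s_b] in the
    place of the range projection. *)
Lemma image_letter D : U D ->
  U (image_word X [:: b] D) /\
  gen_s b * gen_p D * gen_t b = gen_p (image_word X [:: b] D).
Proof.
elim=> {D} [v w Lv Lw | | D UD [UbD ebD] | D E UD [UbD ebD] UE [UbE ebE]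
  | D E UD [UbD ebD] UE [UbE ebE]].
- have [Lbw | nLbw] := EM (language X (b :: w)).
    have -> : image_word X [:: b] (follower_set X v w) = follower_set X v (b :: w).
      apply/seteqP; split=> y.
        by case=> Xy [_ [x [-> _ Xvx]] yx]; exists x; split.
      case=> x [yx Xy Xvx]; split=> //; exists (word_cat w x) => //.
      exists x; split=> //; move: Xy; rewrite yx.
      exact: (@subshift_tail _ _ X_subshift [:: b]).
    split; first exact: fa_gen.
    by rewrite -!word_rel //= !mulrA.
  have e0 x : ~ X (word_cat [:: b] (word_cat w x)).
    by rewrite -word_cat_cat => /language_word_cat.
  have -> : image_word X [:: b] (follower_set X v w) = set0.
    by apply/seteqP; split=> // y [Xy [_ [x [-> _ _]] yx]]; move: Xy; rewrite yx => /e0.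
  split; first exact: follower_algebra0.
  rewrite gen_p0 -(gen_sts b) -(mulrA (gen_s b)) gen_ts -(mulrA (gen_s b)).
  rewrite -gen_pI //; last exact: fa_gen.
  rewrite (_ : dom `&` _ = set0) ?gen_p0 ?mulr0 ?mul0r //.
  apply/seteqP; split=> // y [[z [-> _ Xbz]] [x [zx _ _]]].
  by move: Xbz; move: zx => /= -> /e0.
- split; last by rewrite gen_pX mulr1 gen_st follower_set_ran.
  by rewrite -follower_set_ran.
- have -> : image_word X [:: b] (X `\` D) = ran `\` image_word X [:: b] D.
    rewrite follower_set_ran; apply/seteqP; split=> y.
      case=> Xy [z [Xz nDz] yz]; split; first by split=> //; exists z.
      by case=> _ [u Du]; rewrite yz => /word_cat_inj zu; rewrite zu in nDz.
    case=> -[Xy [z Xz yz]] nDy; split=> //; exists z => //; split=> // Dz.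
    by apply: nDy; split=> //; exists z.
  split; first exact: follower_algebraD.
  rewrite gen_pC // mulrBr mulrBl mulr1 ebD gen_st (gen_p_split U_ran UbD).
  have -> : ran `&` image_word X [:: b] D = image_word X [:: b] D.
    rewrite setIC setIidl // follower_set_ran => y [Xy [z Dz yz]].
    by split=> //; exists z => //; exact: (follower_algebra_sub UD Dz).
  by rewrite addrAC subrr add0r.
- have eI : image_word X [:: b] (D `&` E) =
      image_word X [:: b] D `&` image_word X [:: b] E.
    apply/seteqP; split=> y.
      by case=> Xy [z [Dz Ez] yz]; split; split=> //; exists z.
    case=> -[Xy [z Dz yz]] [_ [u Eu]]; rewrite yz => /word_cat_inj zu.
    by rewrite -yz; split=> //; exists z => //; split=> //; rewrite zu.
  split; first by rewrite eI; exact: fa_cap.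
  rewrite eI [RHS](gen_pI UbD UbE) -ebD -ebE gen_pI //.
  rewrite -!mulrA (mulrA (gen_t b)) gen_ts (mulrA (gen_p dom)) gen_p_comm //.
  by rewrite -gen_ts -!mulrA (mulrA (gen_t b)) gen_tst.
- have eU : image_word X [:: b] (D `|` E) =
      image_word X [:: b] D `|` image_word X [:: b] E.
    apply/seteqP; split=> y.
      by case=> Xy [z [Dz|Ez] yz]; [left | right]; split=> //; exists z.
    by case=> -[Xy [z Dz yz]]; split=> //; exists z => //; solve [by left | by right].
  have eI : image_word X [:: b] D `&` image_word X [:: b] E =
      image_word X [:: b] (D `&` E).
    apply/seteqP; split=> y; last first.
      by case=> Xy [z [Dz Ez] yz]; split; split=> //; exists z.
    case=> -[Xy [z Dz yz]] [_ [u Eu]]; rewrite yz => /word_cat_inj zu.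
    by rewrite -yz; split=> //; exists z => //; split=> //; rewrite zu.
  split; first by rewrite eU; exact: fa_cup.
  rewrite eU gen_pU // [RHS](gen_pU UbD UbE) mulrBr mulrDr mulrBl mulrDl ebD ebE.
  congr (_ - _); rewrite gen_pI // (gen_pI UbD UbE) -ebD -ebE.
  rewrite -!mulrA (mulrA (gen_t b)) gen_ts (mulrA (gen_p dom)) gen_p_comm //.
  by rewrite -gen_ts -!mulrA (mulrA (gen_t b)) gen_tst.
Qed.

End Letter.

Lemma preimage_word_algebra w E : letters_in X w -> U E -> U (preimage_word w E).
Proof.
elim: w E => //= a w IH E [La Lw] UE.
have [UaE _] := preimage_letter La UE; exact: (IH _ Lw UaE).
Qed.

Lemma image_word_cons a w D :
  image_word X (a :: w) D = image_word X [:: a] (image_word X w D).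
Proof.
apply/seteqP; split=> y; last first.
  by case=> Xy [u [_ [z Dz ->]] yu]; split=> //; exists z.
case=> Xy [z Dz yz]; split=> //; exists (word_cat w z) => //.
split; last by exists z.
by move: Xy; rewrite yz; exact: (@subshift_tail _ _ X_subshift [:: a]).
Qed.

Lemma image_word0 D : U D -> image_word X [::] D = D.
Proof.
move=> UD; apply/seteqP; split=> [y [_ [z Dz ->]] // | y Dy].
by split; [exact: follower_algebra_sub Dy | exists y].
Qed.

Lemma image_word_algebra w D : letters_in X w -> U D -> U (image_word X w D).
Proof.
elim: w => [_ UD | a w IH [La Lw] UD]; first by rewrite image_word0.
rewrite image_word_cons; exact: (proj1 (image_letter La (IH Lw UD))).
Qed.

Lemma word_ps w E : letters_in X w -> U E ->
  gen_p E * word_s w = word_s w * gen_p (preimage_word w E).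
Proof.
elim: w E => [|a w IH] E /=; first by rewrite mulr1 mul1r.
case=> La Lw UE; rewrite mulrA gen_ps // -mulrA IH ?mulrA //.
by have [] := preimage_letter La UE.
Qed.

Lemma word_tp w E : letters_in X w -> U E ->
  word_t w * gen_p E = gen_p (preimage_word w E) * word_t w.
Proof.
elim: w E => [|a w IH] E /=; first by rewrite mulr1 mul1r.
case=> La Lw UE; rewrite -mulrA gen_tp // !mulrA IH //.
by have [] := preimage_letter La UE.
Qed.

Lemma word_spt w D : letters_in X w -> U D ->
  word_s w * gen_p D * word_t w = gen_p (image_word X w D).
Proof.
elim: w => [_ UD | a w IH [La Lw] UD]; first by rewrite image_word0 //= mul1r mulr1.
rewrite image_word_cons -(proj2 (image_letter La (image_word_algebra Lw UD))).
by rewrite -IH //= !mulrA.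
Qed.

Lemma word_s_dom w : letters_in X w ->
  word_s w = word_s w * gen_p (preimage_word w X).
Proof. by move=> Lw; rewrite -(word_ps Lw (fa_top X)) gen_pX mul1r. Qed.

Lemma word_t_dom w : letters_in X w ->
  word_t w = gen_p (preimage_word w X) * word_t w.
Proof. by move=> Lw; rewrite -(word_tp Lw (fa_top X)) gen_pX mulr1. Qed.

Local Notation xpoint := (xpoint X).
Local Notation arrow := (arrow X).
Local Notation symbol := (symbol A).

(** * Monomials as indicator functions of bisections *)

Record monomial := Monomial {
  mon_s : seq A; mon_p : set (nat -> A); mon_t : seq A;
  mon_sP : letters_in X mon_s; mon_pP : U mon_p; mon_tP : letters_in X mon_t }.

Implicit Types (m n : monomial) (g : arrow).

Definition mon m : B := word_s (mon_s m) * gen_p (mon_p m) * word_t (mon_t m).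

(* The arrow [(y, k, z)] stands for the element of degree [k] of the tail
   equivalence groupoid taking [z] to [y]; [mon m] is its indicator function
   of [msupp m]. *)
Definition msupp m : set arrow := [set g | exists u, [/\ mon_p m u,
  val g.1.1 = word_cat (mon_s m) u, val g.2 = word_cat (mon_t m) u
  & g.1.2 = (size (mon_s m))%:Z - (size (mon_t m))%:Z]].

(** The middle projection can be cut down to the points [u] that stay in [X] when prefixed by either
    word; each of them gives an arrow of the support. *)
Lemma mon0 m : (forall g, ~ msupp m g) -> mon m = 0.
Proof.
case: m => v D w Lv UD Lw m0; rewrite /mon /=.
rewrite (word_s_dom Lv) (word_t_dom Lw) !mulrA.
have Uv := preimage_word_algebra Lv (fa_top X).
have Uw := preimage_word_algebra Lw (fa_top X).
rewrite -!(mulrA (word_s v)) -!gen_pI //; last exact: fa_cap.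
rewrite (_ : _ `&` _ = set0) ?gen_p0 ?mul0r ?mulr0 //.
apply/seteqP; split=> // u [[Xvu Du] Xwu].
by case: (m0 (@pt _ X (word_cat v u) Xvu, (size v)%:Z - (size w)%:Z,
  @pt _ X (word_cat w u) Xwu)); exists u.
Qed.

(** Either the words of [n] extend those of [m] by one common word [u], and the middle sets are
    compared through images and preimages under [u], or the supports are disjoint. In both cases the
    intersection and the differences are supports of single monomials. *)
Lemma mon_split_prefix m n : (size (mon_s m) <= size (mon_s n))%N ->
  exists c d e, [/\ msupp c = msupp m `&` msupp n,
    msupp d = msupp m `\` msupp n, msupp e = msupp n `\` msupp m,
    mon m = mon c + mon d & mon n = mon c + mon e].
Proof.
case: m n => v D w Lv UD Lw [v' D' w' Lv' UD' Lw'] /= vv'.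
have [[u [v'E w'E]] | nu] := EM (exists u, v' = v ++ u /\ w' = w ++ u); last first.
  exists (Monomial Lv (follower_algebra0 X) Lw), (Monomial Lv UD Lw),
    (Monomial Lv' UD' Lw').
  have disj g : msupp (Monomial Lv UD Lw) g -> msupp (Monomial Lv' UD' Lw') g -> False.
    case=> x /= [_ yx zx kE] [x' /= [_ yx' zx' kE']]; apply: nu.
    rewrite yx in yx'; have [u v'E xu] := word_cat_prefix vv' yx'.
    exists u; split=> //; rewrite zx xu -word_cat_cat in zx'.
    (* The arrow has only one degree, so the difference of lengths is the same for both
       monomials. *)
    have sw : size w' = size (w ++ u).
      by move: kE'; rewrite kE v'E !size_cat; lia.
    have [|r w'E _] := word_cat_prefix _ zx'; first by rewrite sw.
    move: sw; rewrite w'E size_cat -[RHS]addn0 => /addnI/size0nil ->.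
    by rewrite cats0.
  have c0 : mon (Monomial Lv (follower_algebra0 X) Lw) = 0.
    by apply: mon0 => g [? []].
  split; rewrite ?c0 ?add0r //; apply/seteqP; split=> g.
  - by case=> ? [].
  - by case=> mg ng; case: (disj _ mg ng).
  - by move=> mg; split=> // /(disj _ mg).
  - by case.
  - by move=> ng; split=> // mg; exact: disj ng.
  - by case.
have [_ Lu] : letters_in X v /\ letters_in X u by apply/letters_in_cat; rewrite -v'E.
have UuD := preimage_word_algebra Lu UD; have UuD' := image_word_algebra Lu UD'.
exists (Monomial Lv' (fa_cap UD' UuD) Lw'),
  (Monomial Lv (follower_algebraD UD UuD') Lw),
  (Monomial Lv' (follower_algebraD UD' UuD) Lw'); subst v' w'.
have kE : (size (v ++ u))%:Z - (size (w ++ u))%:Z = (size v)%:Z - (size w)%:Z.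
  by rewrite !size_cat !PoszD opprD addrACA subrr addr0.
split.
- apply/seteqP; split=> g /=.
    case=> x /= [[D'x Dux] yx zx gk]; split; last by exists x.
    by exists (word_cat u x); rewrite -!word_cat_cat -kE.
  case=> -[x /= [Dx yx zx gk]] [x' /= [D'x' yx' zx' gk']].
  exists x'; split=> //; split=> //; rewrite /preimage_word /=.
  by move: yx'; rewrite yx word_cat_cat => /word_cat_inj <-.
- apply/seteqP; split=> g /=.
    case=> x /= [[Dx nDx] yx zx gk]; split; first by exists x.
    case=> x' /= [D'x' yx' _ _]; apply: nDx; split.
      exact: follower_algebra_sub Dx.
    by exists x' => //; move: yx'; rewrite yx word_cat_cat => /word_cat_inj.
  case=> -[x /= [Dx yx zx gk]] nm; exists x; split=> //; split=> //.
  case=> Xx [x' D'x' xx']; apply: nm; exists x'.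
  by rewrite !word_cat_cat kE -xx'.
- apply/seteqP; split=> g /=.
    case=> x /= [[D'x nDx] yx zx gk]; split; first by exists x.
    case=> x' /= [Dx' yx' _ _]; apply: nDx; rewrite /preimage_word /=.
    by move: yx; rewrite yx' word_cat_cat => /word_cat_inj <-.
  case=> -[x /= [D'x yx zx gk]] nm; exists x; split=> //; split=> // Dux.
  by apply: nm; exists (word_cat u x); rewrite -!word_cat_cat -kE.
- rewrite /mon /= (gen_p_split UD UuD') mulrDr mulrDl; congr (_ + _).
  have DE : D `&` image_word X u D' = image_word X u (D' `&` preimage_word u D).
    rewrite image_word_preimage setIC; congr (_ `&` _).
    by rewrite setIC setIidl //; exact: follower_algebra_sub.
  rewrite DE -word_spt //; last exact: fa_cap.
  by rewrite word_s_cat word_t_cat !mulrA.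
- by rewrite /mon /= (gen_p_split UD' UuD) mulrDr mulrDl.
Qed.

Lemma mon_split m n : exists cd : monomial * monomial,
  [/\ msupp cd.1 = msupp m `&` msupp n, msupp cd.2 = msupp m `\` msupp n
    & mon m = mon cd.1 + mon cd.2].
Proof.
have [le_mn | /ltnW le_nm] := leqP (size (mon_s m)) (size (mon_s n)).
  by have [c [d [e [cE dE _ mE _]]]] := mon_split_prefix le_mn; exists (c, d).
have [c [d [e [cE _ eE _ mE]]]] := mon_split_prefix le_nm; exists (c, e).
by rewrite setIC.
Qed.

Definition mcap m n : monomial := (projT1 (cid (mon_split m n))).1.
Definition mdiff m n : monomial := (projT1 (cid (mon_split m n))).2.

Lemma msupp_cap m n : msupp (mcap m n) = msupp m `&` msupp n.
Proof. by rewrite /mcap; case: cid => cd []. Qed.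

Lemma msupp_diff m n : msupp (mdiff m n) = msupp m `\` msupp n.
Proof. by rewrite /mdiff; case: cid => cd []. Qed.

Lemma mon_cap_diff_chosen m n : mon m = mon (mcap m n) + mon (mdiff m n).
Proof. by rewrite /mcap /mdiff; case: cid => cd []. Qed.

(** Both monomials equal their common part, because the two differences have empty support. *)
Lemma mon_eq m n : msupp m = msupp n -> mon m = mon n.
Proof.
move=> mn; have diff0 (d : monomial) : msupp d = set0 -> mon d = 0.
  by move=> d0; apply: mon0 => g; rewrite d0.
have [le_mn | /ltnW le_nm] := leqP (size (mon_s m)) (size (mon_s n)).
  have [c [d [e [_ dE eE -> ->]]]] := mon_split_prefix le_mn.
  by rewrite (diff0 d) ?(diff0 e) // ?dE ?eE mn setDv.
have [c [d [e [_ dE eE -> ->]]]] := mon_split_prefix le_nm.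
by rewrite (diff0 d) ?(diff0 e) // ?dE ?eE mn setDv.
Qed.

Lemma mon_cap_diff m n c d : msupp c = msupp m `&` msupp n ->
  msupp d = msupp m `\` msupp n -> mon m = mon c + mon d.
Proof.
move=> cE dE; rewrite (mon_cap_diff_chosen m n).
by congr (_ + _); apply: mon_eq; rewrite ?msupp_cap ?msupp_diff ?cE ?dE.
Qed.

Local Notation combination := (seq (monomial * B)).
Definition lincomb (l : combination) : B := \sum_(q <- l) mon q.1 * q.2.
(** The value at [g] of the [B]-valued function on arrows that [l] represents. *)
Definition fiber (l : combination) (g : arrow) : B :=
  \sum_(q <- l | `[< msupp q.1 g >]) q.2.

(* Injectivity of the map from [mon]-combinations to functions on arrows, with
   coefficients in a left module and relative to a submodule. *)
Section Independence.
Variables (P Q : B -> Prop).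
Hypotheses (P0 : P 0) (Q0 : Q 0).
Hypothesis QD : forall b c : B, Q b -> Q c -> Q (b + c).
Hypothesis PQ : forall m (c : B), P c -> Q (mon m * c).

(** Induction on [l], cutting [m] along the support of the head: on the intersection the coefficient
    of the head is added to [v], on the difference it does not contribute. At the end [v] is the
    constant value of the function on what is left of [m]. *)
Lemma lincomb_restrict l m (v : B) :
  (forall g, msupp m g -> P (v + fiber l g)) ->
  Q (mon m * v + \sum_(q <- l) mon (mcap m q.1) * q.2).
Proof.
elim: l m v => [|q l IH] m v Pv.
  rewrite big_nil addr0; have [[g mg] | ng] := EM (exists g, msupp m g).
    by apply: PQ; have := Pv g mg; rewrite /fiber big_nil addr0.
  by rewrite mon0 ?mul0r // => g mg; apply: ng; exists g.
have IHc : Q (mon (mcap m q.1) * (v + q.2) +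
    \sum_(r <- l) mon (mcap (mcap m q.1) r.1) * r.2).
  apply: IH => g; rewrite msupp_cap => -[mg qg]; have := Pv g mg.
  by rewrite /fiber big_cons asboolT // addrA.
have IHd : Q (mon (mdiff m q.1) * v +
    \sum_(r <- l) mon (mcap (mdiff m q.1) r.1) * r.2).
  apply: IH => g; rewrite msupp_diff => -[mg qg]; have := Pv g mg.
  by rewrite /fiber big_cons asboolF.
have := QD IHc IHd; congr Q; rewrite addrACA -big_split /= big_cons.
rewrite mulrDr (mon_cap_diff_chosen m q.1) mulrDl -!addrA; congr (_ + _).
rewrite addrCA; congr (_ + (_ + _)); apply: eq_bigr => r _; rewrite -mulrDl.
congr (_ * _); apply/esym/(@mon_cap_diff _ q.1).
  by rewrite !msupp_cap setIAC.
by rewrite !msupp_cap msupp_diff !setDE setIAC.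
Qed.

(** [lincomb_restrict] treats the part over the support of the head; the rest is a shorter
    combination, with this support removed from every monomial. *)
Lemma lincomb_fiber l : (forall g, P (fiber l g)) -> Q (lincomb l).
Proof.
have [n] := ubnP (size l); elim: n l => // n IH [|q l] /=.
  by rewrite /lincomb big_nil.
rewrite ltnS => ln Pl.
have Qr : Q (mon q.1 * q.2 + \sum_(r <- l) mon (mcap q.1 r.1) * r.2).
  apply: lincomb_restrict => g qg; have := Pl g.
  by rewrite /fiber big_cons asboolT.
have Qd : Q (lincomb [seq (mdiff r.1 q.1, r.2) | r <- l]).
  apply: IH => [|g]; first by rewrite size_map.
  rewrite /fiber big_map /=; have [qg | nqg] := EM (msupp q.1 g).
    rewrite big_pred0 // => r; apply/asboolF; rewrite msupp_diff.
    by case=> _ /(_ qg).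
  have := Pl g; rewrite /fiber big_cons asboolF //; congr P.
  apply: eq_bigl => r; apply: asbool_equiv_eq; rewrite msupp_diff.
  by split=> [rg | []].
have := QD Qr Qd; rewrite /lincomb big_map big_cons -addrA -big_split /=.
congr Q; congr (_ + _); apply: eq_bigr => r _; rewrite -mulrDl.
congr (_ * _); apply/esym/(@mon_cap_diff _ q.1); last by rewrite msupp_diff.
by rewrite msupp_cap setIC.
Qed.

End Independence.

Lemma mon_p_mul D m : U D -> exists n, gen_p D * mon m = mon n.
Proof.
case: m => v E w Lv UE Lw UD; have UvD := preimage_word_algebra Lv UD.
exists (Monomial Lv (fa_cap UvD UE) Lw).
by rewrite /mon /= !mulrA word_ps // gen_pI // !mulrA.
Qed.

Lemma mon_s_mul a m : language X [:: a] -> exists n, gen_s a * mon m = mon n.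
Proof.
case: m => v E w Lv UE Lw La; exists (@Monomial (a :: v) E w (conj La Lv) UE Lw).
by rewrite /mon /= !mulrA.
Qed.

(** The letter [t_a] passes the projection if the left word is empty, is annihilated by a different
    first letter, and forms a domain projection with the same first letter. *)
Lemma mon_t_mul a m : language X [:: a] -> exists n, gen_t a * mon m = mon n.
Proof.
case: m => -[|b v] E w Lv UE Lw La.
  have [UaE _] := preimage_letter La UE.
  have Lwa : letters_in X (w ++ [:: a]) by apply/letters_in_cat.
  exists (@Monomial [::] _ _ I UaE Lwa).
  by rewrite /mon /= !mul1r mulrA gen_tp // word_t_cat /= mul1r mulrA.
case: Lv => Lb Lv; have [ab | ab] := EM (a = b); last first.
  exists (@Monomial [::] _ [::] I (follower_algebra0 X) I).
  by rewrite /mon /= gen_p0 !mulrA gen_ts_neq // mulr0 !mul0r.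
have Ud : U (follower_set X [:: a] [::]) by exact: fa_gen.
have [n nE] := mon_p_mul (Monomial Lv UE Lw) Ud; exists n.
by rewrite -nE -gen_ts // /mon /= -ab !mulrA.
Qed.

(** * The action on paths *)

Variables (R : comPzRingType) (cst : {rmorphism R -> B}) (x0 : xpoint).
Hypothesis cst_central : forall (r : R) (b : B), cst r * b = b * cst r.

Local Notation gpath := (gpath X).
Local Notation vac := (@vacuum A X R).
Implicit Types (F G : gpath -> R) (L : seq (symbol * arrow)) (e : symbol) (r : R).

Variable act : B -> (gpath -> R) -> gpath -> R.
Hypothesis act_add : forall (b c : B) F P, act (b + c) F P = act b F P + act c F P.
Hypothesis act_mul : forall (b c : B) F, act (b * c) F = act b (act c F).
Hypothesis act_cst : forall r F P, act (cst r) F P = r * F P.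
Hypothesis act_p : forall D F, U D -> act (gen_p D) F = p_op D F.
Hypothesis act_s : forall a F, act (gen_s a) F =
  if `[< language X [:: a] >] then s_op X_subshift a F
  else symbol_op x0 (a, false, false) F.
Hypothesis act_t : forall a F, act (gen_t a) F =
  if `[< language X [:: a] >] then t_op a F
  else symbol_op x0 (a, true, true) F.

Lemma act0 F P : act 0 F P = 0.
Proof. by rewrite -(rmorph0 cst) act_cst mul0r. Qed.

Lemma act_sum (T : Type) (l : seq T) (C : pred T) (f : T -> B) F P :
  act (\sum_(q <- l | C q) f q) F P = \sum_(q <- l | C q) act (f q) F P.
Proof.
elim: l => [|q l IH]; first by rewrite !big_nil act0.
by rewrite !big_cons; case: (C q); rewrite ?act_add IH.
Qed.

Lemma act_word_s w F : letters_in X w ->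
  act (word_s w) F = word_s_op X_subshift w F.
Proof.
elim: w => [_ | a w IH [La Lw]] /=.
  by apply/funext => P; rewrite -(rmorph1 cst) act_cst mul1r.
by rewrite act_mul act_s (asboolT La) IH.
Qed.

Lemma act_word_t w F : letters_in X w -> act (word_t w) F = word_t_op w F.
Proof.
elim: w F => [|a w IH] F /= => [_ | [La Lw]].
  by apply/funext => P; rewrite -(rmorph1 cst) act_cst mul1r.
by rewrite act_mul act_t (asboolT La) IH.
Qed.

Lemma act_mon m F (y u y' : xpoint) k z L :
  mon_p m (val u) -> val y = word_cat (mon_s m) (val u) ->
  val y' = word_cat (mon_t m) (val u) ->
  act (mon m) F (y, k, z, L) =
  F (y', k - (size (mon_s m))%:Z + (size (mon_t m))%:Z, z, L).
Proof.
case: m => v D w Lv UD Lw /= Du yu y'u; rewrite /mon /= !act_mul.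
rewrite act_word_s // act_word_t // act_p //.
rewrite (word_s_opE _ _ _ _ _ yu) /p_op asboolT //.
by rewrite (word_t_opE X_subshift _ _ _ _ y'u).
Qed.

Lemma act_mon0 m F (y : xpoint) k z L :
  (forall u y' : xpoint, mon_p m (val u) -> val y = word_cat (mon_s m) (val u) ->
    val y' <> word_cat (mon_t m) (val u)) ->
  act (mon m) F (y, k, z, L) = 0.
Proof.
case: m => v D w Lv UD Lw /= ny; rewrite /mon /= !act_mul.
have [[u yu] | nu] := EM (exists u : xpoint, val y = word_cat v (val u)); last first.
  by rewrite act_word_s // word_s_op0 // => u yu; apply: nu; exists u.
rewrite act_word_s // act_word_t // act_p //.
rewrite (word_s_opE _ _ _ _ _ yu) /p_op; case: asboolP => // Du.
by apply: (word_t_op0 X_subshift) => Xwu; exact: (ny u (pt Xwu) Du yu).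
Qed.

(** A monomial changes only the first component of the first arrow and translates its degree, so a
    relation that is uniform in both persists. *)
Lemma act_mon_transfer m F G (d : int) (z z' : xpoint) L L' r (y : xpoint) (k : int) :
  (forall (y : xpoint) (k : int), F (y, k + d, z, L) = G (y, k, z', L') * r) ->
  act (mon m) F (y, k + d, z, L) = act (mon m) G (y, k, z', L') * r.
Proof.
move=> FG; have [[u [y' [Du yu y'u]]] | nu] := EM (exists u y' : xpoint,
  [/\ mon_p m (val u), val y = word_cat (mon_s m) (val u)
    & val y' = word_cat (mon_t m) (val u)]).
  rewrite !(act_mon _ _ _ _ Du yu y'u) -FG; congr (F (_, _, _, _)).
  by rewrite -!addrA; congr (_ + _); rewrite addrC -addrA.
have ny (u y' : xpoint) : mon_p m (val u) -> val y = word_cat (mon_s m) (val u) ->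
    val y' <> word_cat (mon_t m) (val u).
  by move=> Du yu y'u; apply: nu; exists u, y'.
by rewrite !act_mon0 ?mul0r.
Qed.

(** Convolving a bisection with the identity gives its indicator function back. *)
Lemma act_mon_units m c g L :
  act (mon m) (at_units c) (g, L) = if `[< msupp m g >] then c L else 0.
Proof.
case: g => -[y k] z; have [[u [y' [Du yu y'u]]] | nu] := EM (exists u y' : xpoint,
  [/\ mon_p m (val u), val y = word_cat (mon_s m) (val u)
    & val y' = word_cat (mon_t m) (val u)]).
  rewrite (act_mon _ _ _ _ Du yu y'u) /at_units /is_unit /=.
  congr (if _ then _ else _); apply: asbool_equiv_eq; split.
    case=> y'z k0; exists (val u); rewrite -y'z; split=> //=.
    by apply/eqP; rewrite -subr_eq0 opprD opprK addrA k0.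
  case=> u' /= [_ yu' zu' ->].
  rewrite yu in yu'; move/word_cat_inj: yu' => uu'.
  split; last by rewrite addrAC subrK subrr.
  by apply: val_inj; rewrite y'u uu'; exact: esym.
rewrite act_mon0 => [|u y' Du yu y'u]; last by apply: nu; exists u, y'.
rewrite asboolF // => -[u /= [Du yu zu _]]; apply: nu.
have Xu := follower_algebra_sub (mon_pP m) Du.
by exists (pt Xu), z.
Qed.

Lemma act_mon_bounded (n : nat) m F : bounded n F -> bounded n (act (mon m) F).
Proof.
move=> Fn [[y k] z] L nL; rewrite -(addr0 k).
rewrite (@act_mon_transfer m F (fun=> 0) 0 z z L L 0) ?mulr0 // => y' k'.
by rewrite Fn ?mul0r.
Qed.

(** * The filtration by the number of free symbols *)

Definition free_symbol : Type := {e : symbol | ~ language X [:: e.1.1]}.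
Implicit Types (fs : free_symbol) (V W : set B).

(* [(a, b, c)] encodes [i_a], [j_a] ([b = false], [true]) followed by [p_a],
   [q_a] ([c = false], [true]), for factorizations [s_a = i_a p_a] and
   [t_a = j_a q_a] with [p_a j_a = 1] and [q_a i_a = 1]. *)
Definition symb e : B :=
  match e with
  | (a, false, false) => gen_s a
  | (a, true, true) => gen_t a
  | (a, false, true) => gen_s a * gen_t a
  | (a, true, false) => gen_t a * gen_s a
  end.

Lemma symbM a (b c d : bool) :
  symb (a, b, c) * symb (a, ~~ c, d) = symb (a, b, d).
Proof.
by case: b; case: c; case: d; rewrite /symb /= ?mulrA ?gen_sts ?gen_tst.
Qed.

Lemma act_symb fs F : act (symb (sval fs)) F = symbol_op x0 (sval fs) F.
Proof.
case: fs => [[[a b] c] /= nLa].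
by case: b; case: c; rewrite /= ?act_mul !(act_s, act_t) (asboolF nLa) //;
  [exact: (@symbol_opM _ _ _ _ a true true false)
  |exact: (@symbol_opM _ _ _ _ a false false true)].
Qed.

Definition span_symb V : set B := [set x |
  exists l : seq (free_symbol * {v : B | V v}),
    x = \sum_(q <- l) symb (sval q.1) * sval q.2].

Definition span_mon V : set B := [set x |
  exists l : seq (monomial * {v : B | V v}),
    x = \sum_(q <- l) mon q.1 * sval q.2].

Lemma span_symb_gen V fs (v : B) : V v -> span_symb V (symb (sval fs) * v).
Proof. by move=> Vv; exists [:: (fs, exist _ v Vv)]; rewrite big_seq1. Qed.

Lemma span_mon_gen V m (v : B) : V v -> span_mon V (mon m * v).
Proof. by move=> Vv; exists [:: (m, exist _ v Vv)]; rewrite big_seq1. Qed.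

Lemma span_symb0 V : span_symb V 0.
Proof. by exists [::]; rewrite big_nil. Qed.

Lemma span_mon0 V : span_mon V 0.
Proof. by exists [::]; rewrite big_nil. Qed.

Lemma span_symbD V (v w : B) : span_symb V v -> span_symb V w -> span_symb V (v + w).
Proof. by move=> [l ->] [l' ->]; exists (l ++ l'); rewrite big_cat. Qed.

Lemma span_monD V (v w : B) : span_mon V v -> span_mon V w -> span_mon V (v + w).
Proof. by move=> [l ->] [l' ->]; exists (l ++ l'); rewrite big_cat. Qed.

Lemma span_symb_ind V (Q : B -> Prop) : Q 0 ->
  (forall v w : B, Q v -> Q w -> Q (v + w)) ->
  (forall fs (v : B), V v -> Q (symb (sval fs) * v)) ->
  forall v : B, span_symb V v -> Q v.
Proof. by move=> Q0 QD Qg v [l ->]; apply: big_ind => // q _; apply/Qg/svalP. Qed.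

Lemma span_mon_ind V (Q : B -> Prop) : Q 0 ->
  (forall v w : B, Q v -> Q w -> Q (v + w)) ->
  (forall m (v : B), V v -> Q (mon m * v)) ->
  forall v : B, span_mon V v -> Q v.
Proof. by move=> Q0 QD Qg v [l ->]; apply: big_ind => // q _; apply/Qg/svalP. Qed.

Definition scalars : set B := [set b | exists r, b = cst r].

(** Sums of products that alternate monomials and free symbols, with at most [d] symbols and a
    scalar at the right end. *)
Fixpoint filtration (d : nat) : set B :=
  if d is d'.+1 then
    [set x | exists b c : B, [/\ span_mon scalars b,
       span_mon (span_symb (filtration d')) c & x = b + c]]
  else span_mon scalars.

Lemma filtration0 (d : nat) : filtration d 0.
Proof.
case: d => [|d]; first exact: span_mon0.
by exists 0, 0; rewrite addr0; split=> //; apply: span_mon0.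
Qed.

Lemma filtrationD (d : nat) (x y : B) :
  filtration d x -> filtration d y -> filtration d (x + y).
Proof.
case: d => [|d]; first exact: span_monD.
move=> [b [c [Vb Vc ->]]] [b' [c' [Vb' Vc' ->]]].
by exists (b + b'), (c + c'); rewrite addrACA; split=> //; apply: span_monD.
Qed.

Lemma filtration_scalars (d : nat) (x : B) : span_mon scalars x -> filtration d x.
Proof.
case: d => // d Vx; exists x, 0; rewrite addr0; split=> //; exact: span_mon0.
Qed.

Lemma filtration_step (d : nat) m (v : B) :
  span_symb (filtration d) v -> filtration d.+1 (mon m * v).
Proof.
move=> Vv; exists 0, (mon m * v); rewrite add0r; split=> //; first exact: span_mon0.
exact: span_mon_gen.
Qed.

Lemma filtration_ind (d : nat) (Q : B -> Prop) : Q 0 ->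
  (forall v w : B, Q v -> Q w -> Q (v + w)) ->
  (forall m r, Q (mon m * cst r)) ->
  (forall m fs (v : B), (0 < d)%N -> filtration d.-1 v ->
     Q (mon m * (symb (sval fs) * v))) ->
  forall x : B, filtration d x -> Q x.
Proof.
move=> Q0 QD Qc Qs x.
have Q1 (b : B) : span_mon scalars b -> Q b.
  by apply: span_mon_ind => // m _ [r ->].
case: d Qs => [|d] Qs; first exact: Q1.
move=> [b [c [/Q1 Qb Vc ->]]]; apply: (QD) => //.
apply: span_mon_ind Vc => // m.
apply: (@span_symb_ind _ (fun v : B => Q (mon m * v))) => [|v w|fs v Vv].
- by rewrite mulr0.
- by move=> Qv Qw; rewrite mulrDr; apply: QD.
- exact: Qs.
Qed.

Lemma filtration_mono (d : nat) : filtration d `<=` filtration d.+1.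
Proof.
elim: d => [|d IH] x; first exact: filtration_scalars.
apply: filtration_ind => [|v w|m r|m fs v _ Vv].
- exact: filtration0.
- exact: filtrationD.
- by apply/filtration_scalars/span_mon_gen; exists r.
- exact: (filtration_step _ (span_symb_gen _ (IH _ Vv))).
Qed.

Lemma filtration_mul (d : nat) (b : B) : (forall m, exists n, b * mon m = mon n) ->
  forall x : B, filtration d x -> filtration d (b * x).
Proof.
move=> bm x; apply: (@filtration_ind d (fun x : B => filtration d (b * x))) =>
  [|v w Vv Vw|m r|m fs v d0 Vv].
- by rewrite mulr0; apply: filtration0.
- by rewrite mulrDr; apply: filtrationD.
- have [n nE] := bm m; rewrite mulrA nE.
  by apply/filtration_scalars/span_mon_gen; exists r.
- have [n nE] := bm m; rewrite mulrA nE; case: d d0 Vv => // d _ Vv.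
  exact: (filtration_step _ (span_symb_gen _ Vv)).
Qed.

Lemma filtration_p (d : nat) D : U D ->
  forall x : B, filtration d x -> filtration d (gen_p D * x).
Proof. by move=> UD; apply: filtration_mul => m; exact: mon_p_mul. Qed.

Lemma filtration_s (d : nat) a : language X [:: a] ->
  forall x : B, filtration d x -> filtration d (gen_s a * x).
Proof. by move=> La; apply: filtration_mul => m; exact: mon_s_mul. Qed.

Lemma filtration_t (d : nat) a : language X [:: a] ->
  forall x : B, filtration d x -> filtration d (gen_t a * x).
Proof. by move=> La; apply: filtration_mul => m; exact: mon_t_mul. Qed.

Lemma filtration_cst (d : nat) r (x : B) : filtration d x -> filtration d (cst r * x).
Proof.
have gen (d' : nat) m r' : filtration d' (cst r * (mon m * cst r')).
  rewrite cst_central -mulrA -rmorphM.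
  by apply/filtration_scalars/span_mon_gen; exists (r' * r).
elim: d x => [|d IH] x; apply: (@filtration_ind _ (fun x : B => filtration _ (cst r * x)))
  => [|v w Vv Vw|m r'|m fs v // d0 Vv] //.
- by rewrite mulr0; apply: filtration0.
- by rewrite mulrDr; apply: filtrationD.
- by rewrite mulr0; apply: filtration0.
- by rewrite mulrDr; apply: filtrationD.
- rewrite cst_central -(mulrA (mon m)) -(mulrA (symb _)) -(cst_central r v).
  exact: (filtration_step _ (span_symb_gen _ (IH _ Vv))).
Qed.

Lemma filtrationN (d : nat) (x : B) : filtration d x -> filtration d (- x).
Proof. by rewrite -mulN1r -(rmorph1 cst) -rmorphN; apply: filtration_cst. Qed.

Lemma filtration_mon (d : nat) m (x : B) : filtration d x -> filtration d (mon m * x).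
Proof.
case: m => v D w Lv UD Lw Vx; rewrite /mon /= -!mulrA.
have: filtration d (word_t w * x).
  elim: w x Vx Lw => [|a w IH] x Vx /=; first by rewrite mul1r.
  by case=> La Lw; rewrite -mulrA; apply: IH => //; apply: filtration_t.
move=> /(filtration_p UD) {}Vx; move: (_ * _) Vx => {}x Vx.
elim: v Lv => [|a v IH] /=; first by rewrite mul1r.
by case=> La Lv; rewrite -mulrA; apply: filtration_s => //; apply: IH.
Qed.

Definition one_mon : monomial := @Monomial [::] X [::] I (fa_top X) I.

Lemma mon_one : mon one_mon = 1.
Proof. by rewrite /mon /= gen_pX !mulr1. Qed.

Lemma msupp_one g : msupp one_mon g <-> is_unit g.
Proof.
case: g => -[y k] z; split.
  by case=> u /= [_ yu zu ->]; split=> //; apply: val_inj; rewrite /= yu zu.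
by case=> /= -> ->; exists (val z); split=> //; exact: point_sub.
Qed.

Lemma filtration_symb (d : nat) fs (x : B) :
  filtration d x -> filtration d.+1 (symb (sval fs) * x).
Proof.
move=> Vx; rewrite -[_ * x]mul1r -mon_one.
exact: (filtration_step _ (span_symb_gen _ Vx)).
Qed.

Lemma filtration_le (c d : nat) : (c <= d)%N -> filtration c `<=` filtration d.
Proof.
elim: d => [|d IH]; first by rewrite leqn0 => /eqP ->.
by rewrite leq_eqVlt => /predU1P[-> // | /IH le x /le]; apply: filtration_mono.
Qed.

Hypothesis gen_ind : forall Q : B -> Prop, (forall r, Q (cst r)) ->
  (forall D, U D -> Q (gen_p D)) -> (forall a, Q (gen_s a)) ->
  (forall a, Q (gen_t a)) -> (forall b c : B, Q b -> Q c -> Q (b + c)) ->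
  (forall b c : B, Q b -> Q c -> Q (b * c)) -> forall b : B, Q b.

(** By induction on [b] along the generators, left multiplication by [b] preserves the union of the
    filtration; it is then applied to 1. *)
Lemma filtration_exhaustive (x : B) : exists d, filtration d x.
Proof.
suff mul (b : B) : forall (d : nat) z, filtration d z -> exists d', filtration d' (b * z).
  have : filtration 0 (mon one_mon * cst 1) by apply: span_mon_gen; exists 1.
  by rewrite mon_one rmorph1 mulr1 => /(mul x); rewrite mulr1.
elim/gen_ind: b => [r|D UD|a|a|b c Hb Hc|b c Hb Hc] d z Vz.
- by exists d; apply: filtration_cst.
- by exists d; apply: filtration_p.
- have [La | nLa] := EM (language X [:: a]); first by exists d; apply: filtration_s.
  exists d.+1.
  exact: (@filtration_symb d (exist _ (a, false, false) nLa)).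
- have [La | nLa] := EM (language X [:: a]); first by exists d; apply: filtration_t.
  exists d.+1.
  exact: (@filtration_symb d (exist _ (a, true, true) nLa)).
- have [e He] := Hb _ _ Vz; have [f Hf] := Hc _ _ Vz; exists (maxn e f).
  rewrite mulrDl; apply: filtrationD; first exact: filtration_le (leq_maxl _ _) _ He.
  exact: filtration_le (leq_maxr _ _) _ Hf.
- by have [e He] := Hc _ _ Vz; have [f] := Hb _ _ He; rewrite mulrA; exists f.
Qed.

Lemma act_bounded (d n : nat) F (x : B) : bounded n F -> filtration d x ->
  bounded (d + n) (act x F).
Proof.
move=> Fn; elim: d x => [|d IH] x; apply: (@filtration_ind _ (fun x : B =>
    bounded _ (act x F))) => [|v w Bv Bw|m r|m fs v // _ Vv] //.
1,4: by move=> g L _; rewrite act0.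
1,3: by move=> g L nL; rewrite act_add Bv ?Bw ?addr0.
1,2: rewrite act_mul; apply: act_mon_bounded => g L nL; rewrite act_cst Fn ?mulr0 //.
  by apply: leq_ltn_trans nL; rewrite leq_addl.
rewrite act_mul (act_mul (symb _)) act_symb.
exact/act_mon_bounded/symbol_op_bounded/IH/Vv.
Qed.

Lemma span_symb_units V F (v : B) g L : span_symb V v ->
  act v F (g, L) = if `[< is_unit g >] then act v F (base x0, L) else 0.
Proof.
move: v; apply: span_symb_ind => [|v w Hv Hw|fs v _].
- by rewrite !act0 if_same.
- by rewrite !act_add Hv Hw; case: ifP; rewrite ?addr0.
- by rewrite act_mul act_symb [in LHS]symbol_op_units.
Qed.

Definition forget V (l : seq (monomial * {v : B | V v})) : combination :=
  [seq (q.1, sval q.2) | q <- l].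

Lemma lincomb_forget V (l : seq (monomial * {v : B | V v})) :
  lincomb (forget l) = \sum_(q <- l) mon q.1 * sval q.2.
Proof. by rewrite /lincomb big_map. Qed.

Lemma fiber_span V (l : seq (monomial * {v : B | span_symb V v})) g :
  span_symb V (fiber (forget l) g).
Proof.
rewrite /fiber big_map; apply: big_ind => [|v w|q _]; first exact: span_symb0.
- exact: span_symbD.
- exact: svalP.
Qed.

(** Elements of [span_symb] produce functions [1 (x) c], on which a monomial acts as multiplication
    of [c] by the indicator of its support. *)
Lemma act_fiber V (l : seq (monomial * {v : B | span_symb V v})) F g L :
  act (lincomb (forget l)) F (g, L) = act (fiber (forget l) g) F (base x0, L).
Proof.
rewrite lincomb_forget /fiber big_map !act_sum [RHS]big_mkcond /=.
apply: eq_bigr => -[m [v Vv]] _ /=; rewrite act_mul.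
rewrite [in LHS](_ : act v F = at_units (fun L => act v F (base x0, L))).
  by rewrite act_mon_units.
by apply/funext => -[g' L']; rewrite (span_symb_units _ _ _ Vv).
Qed.

Lemma fiber_scalars (l : seq (monomial * {v : B | scalars v})) g :
  fiber (forget l) g = cst (act (lincomb (forget l)) vac (g, [::])).
Proof.
rewrite lincomb_forget /fiber big_map act_sum rmorph_sum big_mkcond /=.
apply: eq_bigr => -[m [b [r br]]] _ /=; rewrite act_mul {b}br.
rewrite (_ : act (cst r) vac = at_units (fun L => r * (size L == 0%N)%:R)).
  by rewrite act_mon_units; case: ifP; rewrite ?mulr1 // rmorph0.
by apply/funext => P; rewrite act_cst /vacuum /at_units; case: ifP; rewrite ?mulr0.
Qed.

Definition vanishing (d : nat) (x : B) : Prop :=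
  forall g L, size L = d -> act x vac (g, L) = 0.

(** In degree 0 the fibers are scalars, and the image of the vacuum shows their values. *)
Lemma vanishing0 (x : B) : filtration 0 x -> vanishing 0 x -> x = 0.
Proof.
move=> [l xE] x0'; rewrite xE -lincomb_forget.
apply: (@lincomb_fiber (eq^~ 0) (eq^~ 0)) => // [b c -> ->|m c ->|g].
- by rewrite addr0.
- by rewrite mulr0.
- by rewrite fiber_scalars lincomb_forget -xE x0' ?rmorph0.
Qed.

(** On paths of top length a term contributes only if its symbol is the first symbol of the path. *)
Lemma symbol_part (d : nat) (l : seq (free_symbol * {v : B | filtration d v}))
    (C : symbol -> Prop) g e g' L : size L = d ->
  act (\sum_(q <- l | `[< C (sval q.1) >]) symb (sval q.1) * sval q.2) vac
    (g, (e, g') :: L) =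
  if `[< C e >]
  then act (\sum_(q <- l) symb (sval q.1) * sval q.2) vac (g, (e, g') :: L) else 0.
Proof.
move=> sL; rewrite !act_sum.
have top (q : free_symbol * {v : B | filtration d v}) : sval q.1 <> e ->
    act (symb (sval q.1) * sval q.2) vac (g, (e, g') :: L) = 0.
  case: q => fs [v Vv] /= ne; rewrite act_mul act_symb.
  have := act_bounded (@vacuum_bounded A X R) Vv; rewrite addn0 => Bv.
  by rewrite (symbol_op_top _ _ _ _ _ Bv sL) asboolF // => -[_ /esym].
case: asboolP => Ce; rewrite big_mkcond /=; last first.
  apply: big1 => q _; case: asboolP => // Cq.
  by apply: top => qe; rewrite qe in Cq.
apply: eq_bigr => q _; case: asboolP => // nCq.
by rewrite top // => qe; rewrite qe in nCq.
Qed.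

(** The sum is grouped by symbol; by [symbol_part] each group vanishes separately in top degree. The
    case of a single symbol is a hypothesis because it is supplied inductively by
    [vanishing_symb]. *)
Lemma vanishing_span (d : nat) :
  (forall fs (x : B), filtration d x -> vanishing d.+1 (symb (sval fs) * x) ->
     filtration d (symb (sval fs) * x)) ->
  forall v : B, span_symb (filtration d) v -> vanishing d.+1 v -> filtration d v.
Proof.
move=> step v [l ->] van.
apply: (@sum_by_key _ _ _ _ (fun q => sval q.1)) => [||e].
- exact: filtration0.
- exact: filtrationD.
have [Le | nLe] := EM (language X [:: e.1.1]).
  rewrite big_pred0 => [|[[e' nLe'] v'] /=]; first exact: filtration0.
  by apply/asboolF => ee'; rewrite ee' in nLe'.
have eE : \sum_(q <- l | `[< sval q.1 = e >]) symb (sval q.1) * sval q.2 =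
    symb e * \sum_(q <- l | `[< sval q.1 = e >]) sval q.2.
  by rewrite big_distrr; apply: eq_bigr => q /asboolP ->.
rewrite eE; apply: (step (exist _ e nLe)) => /=.
  apply: big_ind => [|x y|q _]; first exact: filtration0.
    exact: filtrationD.
  exact: svalP.
rewrite -eE => g [|[e' g'] L] //= [sL].
by rewrite (@symbol_part d l (fun k => k = e)) // van ?if_same //= sL.
Qed.

(* Modulo [filtration d], the factors of [x] that can be cancelled by [symb fs]
   have a constant left coefficient, their value at [base]; these are
   collected in [Z], and multiplying [Z] by [symb fs] does not raise its
   degree, by [symbM]. *)
Lemma vanishing_symb (d : nat) fs (x : B) : filtration d x ->
  vanishing d.+1 (symb (sval fs) * x) -> filtration d (symb (sval fs) * x).
Proof.
elim: d fs x => [|d IH] [[[a b] c] nLa] x; rewrite [sval _]/=.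
  move=> Vx van; suff -> : x = 0 by rewrite mulr0; exact: (filtration0 0).
  apply: vanishing0 => // g [|//] _.
  (* Prefixing the path by a unit and the symbol recovers the value of [x] at [g]. *)
  have := van (base x0) [:: (a, b, c, g)] erefl.
  rewrite act_mul (@act_symb (exist _ (a, b, c) nLa)) /=.
  have := act_bounded (@vacuum_bounded A X R) Vx => Bx.
  rewrite (symbol_op_top _ _ _ _ _ Bx) // asboolT //.
  by rewrite asboolF ?subr0 // => -[].
have R' := vanishing_span IH.
move=> [y [z [Vy [l zE] xE]]] van; rewrite -lincomb_forget in zE.
have xvac g L : size L = d.+1 ->
    act x vac (g, L) = act (fiber (forget l) g) vac (base x0, L).
  move=> sL; rewrite xE act_add zE act_fiber.
  rewrite (@act_bounded 0 0 _ y (@vacuum_bounded A X R)) ?add0r //.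
  by rewrite addn0 sL.
have Bx : bounded d.+1 (act x vac).
  rewrite -[d.+1]addn0; apply: act_bounded; first exact: vacuum_bounded.
  by exists y, z; split=> //; exists l; rewrite zE lincomb_forget.
have [l0 l0E] := fiber_span l (base x0).
pose C e := e.1 = (a, ~~ c).
pose Z := \sum_(q <- l0 | `[< C (sval q.1) >]) symb (sval q.1) * sval q.2.
have ZV : span_symb (filtration d) Z.
  apply: big_ind => [|v w|q _]; [exact: span_symb0 | exact: span_symbD |].
  exact/span_symb_gen/svalP.
(* As [one_mon] is supported on the unit arrows, the added term subtracts [Z] from the fibers there
   and nowhere else. *)
have corr g : filtration d (fiber ((one_mon, - Z) :: forget l) g).
  have -> : fiber ((one_mon, - Z) :: forget l) g =
      fiber (forget l) g + (if `[< is_unit g >] then - Z else 0).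
    rewrite /fiber big_cons /= [RHS]addrC (asbool_equiv_eq (msupp_one g)).
    by case: ifP; rewrite ?add0r.
  have NZV : span_symb (filtration d) (- Z).
    have [lZ ->] := ZV; rewrite -sumrN; apply: big_ind => [|v w|q _].
    - exact: span_symb0.
    - exact: span_symbD.
    - by rewrite -mulrN; apply/span_symb_gen/filtrationN/svalP.
  apply: R' => [|g' [|[e g''] L] //= [sL]].
    apply: span_symbD; first exact: fiber_span.
    by case: ifP => // _; apply: span_symb0.
  rewrite act_add (span_symb_units _ _ _ (fiber_span _ _)).
  (* On this prefixed path, vanishing says that the value of [x] at [g] is zero, or, if [g] is a
     unit and the remaining path starts with [(a, ~~ c)], equal to its value at [base]. The second
     alternative is what [Z] cancels. *)
  have := van (base x0) ((a, b, c, g) :: (e, g'') :: L) (congr1 (fun k : nat => k.+2) sL).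
  rewrite act_mul (@act_symb (exist _ (a, b, c) nLa)) /=.
  rewrite (symbol_op_top _ _ _ _ _ Bx) /= ?sL // asboolT // !xvac /= ?sL // => e0.
  have actZ : act (- Z) vac (g', (e, g'') :: L) = - (if `[< is_unit g' >] then
      if `[< C e >] then act (fiber (forget l) (base x0)) vac (base x0, (e, g'') :: L)
      else 0 else 0).
    rewrite (span_symb_units _ _ _ NZV); case: ifP => _; last by rewrite oppr0.
    apply/eqP; rewrite -addr_eq0 l0E -symbol_part //; apply/eqP.
    by rewrite -act_add addNr act0.
  case: (asboolP (is_unit g)) => ug; last first.
    rewrite act0 addr0; move: e0; rewrite asboolF ?subr0 => [->|[]] //.
    by rewrite if_same.
  rewrite actZ; case: ifP => _; last by rewrite oppr0 addr0.
  move: e0; rewrite asbool_and (asboolT ug) /=.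
  by rewrite -[C e]/(e.1 = (a, ~~ c)).
have Vc : filtration d (lincomb ((one_mon, - Z) :: forget l)).
  apply: lincomb_fiber corr; [exact: filtration0|exact: filtration0|exact: filtrationD|].
  by move=> m v; apply: filtration_mon.
have -> : symb (a, b, c) * x =
    symb (a, b, c) * (y + lincomb ((one_mon, - Z) :: forget l)) + symb (a, b, c) * Z.
  rewrite -mulrDr xE zE /lincomb big_cons /= mon_one mul1r -addrA.
  by rewrite addrAC addNr add0r.
apply: filtrationD.
  apply: (@filtration_symb d (exist _ (a, b, c) nLa)); apply: (filtrationD _ Vc).
  exact: filtration_scalars.
rewrite /Z big_distrr.
apply: (@big_ind _ (filtration d.+1)) => [|v w|[[[[a' b'] c'] nLa'] v]].
- exact: filtration0.
- exact: filtrationD.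
- move=> /asboolP[/= -> ->]; rewrite [sval _]/= mulrA symbM.
  exact: (@filtration_symb d (exist _ (a, b, c') nLa) _ (svalP v)).
Qed.

(** Top-degree vanishing passes to every fiber, where [vanishing_span] lowers the degree;
    [lincomb_fiber] reassembles the sum. *)
Lemma vanishing_top (d : nat) (x : B) :
  filtration d.+1 x -> vanishing d.+1 x -> filtration d x.
Proof.
move=> [y [z [Vy [l zE] ->]]] van; rewrite -lincomb_forget in zE.
apply: filtrationD; first exact: filtration_scalars.
rewrite zE; apply: (@lincomb_fiber (filtration d)).
- exact: filtration0.
- exact: filtration0.
- exact: filtrationD.
- by move=> m v; apply: filtration_mon.
move=> g; apply: (vanishing_span (@vanishing_symb d)) (fiber_span _ _) _ => g' L sL.
rewrite (span_symb_units _ _ _ (fiber_span _ _)) -act_fiber -zE.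
have := van g L sL; rewrite act_add (@act_bounded 0 0 _ y (@vacuum_bounded A X R)) //.
  by rewrite add0r => ->; rewrite if_same.
by rewrite addn0 sL.
Qed.

(** * Products that do not vanish *)

Definition right_shift (d : int) (h : xpoint -> xpoint) g : arrow :=
  (g.1.1, g.1.2 + d, h g.2).

(** Glues two paths; [f] modifies only the last arrow of the first one, at the junction. *)
Fixpoint concat (f : arrow -> arrow) g L L' : gpath :=
  if L is (e, g') :: L1
  then (g, (e, (concat f g' L1 L').1) :: (concat f g' L1 L').2) else (f g, L').

Lemma size_concat f g L L' : size (concat f g L L').2 = (size L + size L')%N.
Proof. by elim: L g => //= -[e g'] L IH g; rewrite /= IH. Qed.

(* The condition on the last arrow keeps the correction terms of [symbol_op]
   from appearing where the two paths are glued. *)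
Lemma act_concat (n c : nat) (d : int) (h : xpoint -> xpoint) G t (z : xpoint)
    (x : B) g L L' : bounded c G ->
  (forall (y : xpoint) (k : int) L', size L' = c ->
     G (y, k + d, h z, L') = if `[< is_unit (y, k, z) >] then t L' else 0) ->
  filtration n x -> size L = n -> size L' = c ->
  (last g (unzip2 L)).2 = z -> ~ is_unit (right_shift d h (last g (unzip2 L))) ->
  act x G (concat (right_shift d h) g L L') = act x vac (g, L) * t L'.
Proof.
move=> Gc Gz; pose f := right_shift d h; rewrite -/f.
elim: n x g L => [|n IH] x g L.
  move=> Vx; case: L => // _ sL' lz _; rewrite /= in lz.
  case: g lz => -[y k] _ /= ->; rewrite /f /right_shift /=; move: x Vx.
  apply: (@filtration_ind 0 (fun x : B => act x G (y, k + d, h z, L') =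
    act x vac (y, k, z, [::]) * t L')) => [|v w Hv Hw|m r|//].
  - by rewrite !act0 mul0r.
  - by rewrite !act_add Hv Hw mulrDl.
  rewrite !(act_mul (mon m)); apply: act_mon_transfer => y' k'.
  rewrite !act_cst Gz // /vacuum /at_units /=.
  by case: ifP; rewrite ?mulr1 // mulr0 mul0r.
case: L => // -[e g'] L Vx [sL] sL' /= lz nu.
have sc := size_concat f g' L L'.
have IHv (v : B) g1 : filtration n v ->
    last g1 (unzip2 L) = last g' (unzip2 L) ->
    act v G (concat f g1 L L') = act v vac (g1, L) * t L'.
  by move=> Vv l1; apply: IH; rewrite ?l1.
move: x Vx; apply: (@filtration_ind n.+1 (fun x : B =>
    act x G (g, (e, (concat f g' L L').1) :: (concat f g' L L').2) =
    act x vac (g, (e, g') :: L) * t L')) => [|v w Hv Hw|m r|m fs v _ Vv].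
- by rewrite !act0 mul0r.
- by rewrite !act_add Hv Hw mulrDl.
(* A term of degree 0 contributes nothing on paths this long, on either side. *)
- have V0 : filtration 0 (mon m * cst r) by apply: span_mon_gen; exists r.
  rewrite (act_bounded Gc V0) ?(act_bounded (@vacuum_bounded A X R) V0) ?mul0r //=.
  by rewrite sc sL sL' add0n ltnS leq_addl.
case: g => -[y k] zg; rewrite !(act_mul (mon m)) -[in LHS](addr0 k).
apply: act_mon_transfer => y' k'; rewrite addr0 !(act_mul (symb _)) !act_symb.
have BG := act_bounded Gc Vv.
have := act_bounded (@vacuum_bounded A X R) Vv; rewrite addn0 => Bv.
rewrite (symbol_op_top _ _ _ _ _ BG) ?sc ?sL ?sL' // (symbol_op_top _ _ _ _ _ Bv) //.
case: ifP => _; last by rewrite mul0r.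
rewrite mulrBl -surjective_pairing IHv //; congr (_ - _).
(* If [L] is empty, the arrow at the junction is not a unit and there is no correction. Otherwise
   the corrections on both sides have the same condition, and their values are related by
   induction. *)
case: L sL lz nu IHv {sc} => [|[e1 g1] L] sL lz nu IHv /=.
  by rewrite asboolF => [|[]] //; rewrite asboolF ?mul0r // => -[].
case: ifP => _; last by rewrite mul0r.
exact: (IHv v (base x0)).
Qed.

(** In the least degree, vanishing on all paths of that length would lower the degree further, or
    give zero in degree 0. *)
Lemma filtration_minimal (x : B) : x <> 0 -> exists (n : nat) g L,
  [/\ filtration n x, size L = n & act x vac (g, L) <> 0].
Proof.
move=> x0'; have ex : exists d, `[< filtration d x >].
  by have [d Vx] := filtration_exhaustive x; exists d; apply/asboolP.
have [d /asboolP Vx dmin] := ex_minnP ex; exists d.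
have [//|nx] := EM (exists g L, [/\ filtration d x, size L = d & act x vac (g, L) <> 0]).
have van : vanishing d x.
  by move=> g L sL; apply: contrapT => nz; apply: nx; exists g, L.
case: d Vx dmin van {nx} => [|d] Vx dmin van; first by case: x0'; apply: vanishing0.
by have := dmin d (asboolT (vanishing_top Vx van)); rewrite ltnn.
Qed.

Hypothesis R_domain : GRing.integral_domain_axiom R.

Lemma domain_sqr r : r * r = 0 -> r = 0.
Proof. by move/R_domain/orP => [] /eqP. Qed.

(** A path that detects [x] is glued to a copy of itself through the symbol of [s_a]; the value
    there is a square in a domain. *)
Lemma semiprime_free_letter a (x : B) : ~ language X [:: a] ->
  (forall w : B, x * w * x = 0) -> x = 0.
Proof.
move=> nLa xwx; apply: contrapT => /filtration_minimal[n [g [L [Vx sL nz]]]].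
have letter (y : xpoint) : language X [:: val y 0%N].
  apply: (@language_word_cat _ X [:: val y 0%N] (shift (val y))).
  by rewrite word_cat_head_shift; apply: point_sub.
(* If [g] has degree 0, the starred first letter of its range lowers the degree to -1. A first arrow
   that is not a unit avoids the correction of the symbol put before it. *)
have [b [g' [Vbx g'E ng']]] : exists (b : B) g', [/\ filtration n (b * x),
    act (b * x) vac (g', L) = act x vac (g, L) & ~ is_unit g'].
  case: g nz => -[y k] z nz; have [k0 | k0] := eqVneq k 0; last first.
    exists 1, (y, k, z); rewrite mul1r; split=> // -[_ /= k0'].
    by rewrite k0' eqxx in k0.
  exists (gen_t (val y 0%N)), (tail X_subshift y, k - 1, z).
  split; first exact: filtration_t.
    rewrite act_mul act_t (asboolT (letter y)) /t_op.
    case: pselect => [Xy | []]; last by rewrite word_cat_head_shift; apply: point_sub.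
    congr (act _ _ (_, _, _, _)); last by rewrite subrK.
    by apply: val_inj; exact: word_cat_head_shift.
  by case=> _ /=; rewrite k0.
pose fs : free_symbol := exist _ (a, false, false) nLa.
pose F := act (b * x) vac; pose G0 := symbol_op x0 (sval fs) F.
have Fb : bounded n F.
  by rewrite -[n]addn0; apply: act_bounded Vbx; apply: vacuum_bounded.
have G0b : bounded n.+1 G0 by apply: symbol_op_bounded.
pose t L1 := G0 (base x0, L1); pose L' := (sval fs, g') :: L.
have tL' : t L' = act x vac (g, L).
  rewrite /t /G0 (symbol_op_top _ _ _ _ _ Fb) // asboolT //.
  by rewrite asboolF ?subr0 => [|[]].
pose lg := last g (unzip2 L).
(* If the last arrow has degree 0, multiplying by the first letter of its source replaces units by
   arrows of degree 1, whose source has lost that letter. *)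
have [c [d [h [Gb Gz nu]]]] : exists (c : B) (d : int) (h : xpoint -> xpoint),
  [/\ bounded n.+1 (act c G0),
    forall (y : xpoint) (k : int) L', size L' = n.+1 ->
      act c G0 (y, k + d, h lg.2, L') =
      if `[< is_unit (y, k, lg.2) >] then t L' else 0
    & ~ is_unit (right_shift d h lg)].
  have [k0 | k0] := eqVneq lg.1.2 0; last first.
    exists 1, 0, id; have e1 : act 1 G0 = G0.
      by apply/funext => P; rewrite -(rmorph1 cst) act_cst mul1r.
    rewrite e1; split=> // [y k L1 _|].
      by rewrite addr0 {1}/G0 symbol_op_units.
    by case=> _ /= k0'; rewrite addr0 in k0'; rewrite k0' eqxx in k0.
  exists (gen_s (val lg.2 0%N)), 1, (tail X_subshift).
  have actE (y : xpoint) (k : int) (z : xpoint) L1 :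
      act (gen_s (val lg.2 0%N)) G0 (y, k, z, L1) =
      if `[< val y 0%N = val lg.2 0%N >]
      then G0 (tail X_subshift y, k - 1, z, L1) else 0.
    by rewrite act_s (asboolT (letter _)).
  split=> [[[y k] z] L1 nL1|y k L1 _|].
  - by rewrite actE G0b // if_same.
  - rewrite actE addrK {1}/G0 symbol_op_units /at_units /=.
    case: asboolP => [y0 | ny0]; last first.
      by rewrite asboolF // => -[/= yl _]; apply: ny0; rewrite yl.
    congr (if _ then _ else _); apply: asbool_equiv_eq; split=> -[/= yl kk]; split=> //=.
      apply: val_inj; apply/funext => -[|i]; first exact: y0.
      exact: (congr1 (fun u : xpoint => val u i) yl).
    by rewrite yl.
  - by case=> _ /=; rewrite k0.
have := @act_concat n n.+1 d h _ t lg.2 x g L L' Gb Gz Vx sL.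
rewrite /= sL => /(_ erefl erefl nu); rewrite tL' => e.
apply: nz; apply: domain_sqr; rewrite -e.
have := xwx (c * symb (sval fs) * b).
by rewrite /G0 -act_symb /F -!act_mul !mulrA => ->; rewrite act0.
Qed.

(** * The case where every letter occurs in [X] *)

Section NoFreeLetter.
Hypothesis all_letters : forall a, language X [:: a].

Local Notation combo := (seq (monomial * R)).
Implicit Types (l : combo).

Definition coef l g : R := \sum_(q <- l | `[< msupp q.1 g >]) q.2.
(** Ignores cancellation between coefficients, so that bounds can be read off the finite list. *)
Definition reaches l g : bool := has (fun q => `[< msupp q.1 g >]) l.
Definition mdeg m : int := (size (mon_s m))%:Z - (size (mon_t m))%:Z.

(** There are no free symbols, so every stage of the filtration consists of scalar combinations of
    monomials. *)
Lemma combo_exists (x : B) : exists l, x = \sum_(q <- l) mon q.1 * cst q.2.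
Proof.
have [d Vx] := filtration_exhaustive x.
move: x Vx; apply: filtration_ind =>
  [|v w [l ->] [l' ->]|m r|m [e /(_ (all_letters _))] //].
- by exists [::]; rewrite big_nil.
- by exists (l ++ l'); rewrite big_cat.
- by exists [:: (m, r)]; rewrite big_seq1.
Qed.

Lemma act_combo l g :
  act (\sum_(q <- l) mon q.1 * cst q.2) vac (g, [::]) = coef l g.
Proof.
rewrite act_sum /coef [RHS]big_mkcond; apply: eq_bigr => -[m r] _ /=.
rewrite act_mul (_ : act (cst r) vac = at_units (fun L => r * (size L == 0%N)%:R)).
  by rewrite act_mon_units mulr1.
by apply/funext => P; rewrite act_cst /vacuum /at_units; case: ifP; rewrite ?mulr0.
Qed.

Lemma combo_eq0 l : (forall g, coef l g = 0) ->
  \sum_(q <- l) mon q.1 * cst q.2 = 0.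
Proof.
move=> l0; apply: vanishing0 => [|g [|//] _]; last by rewrite act_combo.
apply: big_ind => [|v w|q _]; [exact: span_mon0 | exact: span_monD |].
by apply: span_mon_gen; exists q.2.
Qed.

Lemma coef_reaches l g : coef l g <> 0 -> reaches l g.
Proof. by move=> nz; apply/negPn/negP => nr; apply: nz; exact: big_hasC. Qed.

Lemma reaches_mon l g : reaches l g -> exists m, msupp m g.
Proof. by elim: l => //= q l IH /orP[/asboolP | /IH //]; exists q.1. Qed.

Lemma reaches_bound l : exists K : nat,
  forall (y : xpoint) (k : int) (z : xpoint), reaches l (y, k, z) -> k <= K%:Z.
Proof.
elim: l => [|q l [K HK]]; first by exists 0%N.
exists (K + size (mon_s q.1))%N => y k z /orP[/asboolP[u /= [_ _ _ ->]] | /HK]; lia.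
Qed.

Lemma separate_points (y y' : xpoint) : y <> y' ->
  exists D, [/\ U D, D (val y) & ~ D (val y')].
Proof.
move=> yy'; have [n yn] : exists n : nat, val y n <> val y' n.
  apply: contrapT => ny; apply: yy'; apply: val_inj; apply/funext => n.
  by apply: contrapT => yn; apply: ny; exists n.
have yE := word_cat_mkseq n.+1 (val y); set w := mkseq _ _ in yE.
have Lw : language X w.
  apply: (@language_word_cat _ _ w (iter n.+1 shift (val y))).
  by rewrite yE; apply: point_sub.
exists (follower_set X [::] w); split; first exact: fa_gen language0 Lw.
  exists (iter n.+1 shift (val y)); split; rewrite ?yE //; first exact: point_sub.
  by apply: (@subshift_tail _ _ X_subshift w); rewrite yE; apply: point_sub.
case=> x [y'x _ _]; apply: yn; rewrite -yE y'x.
by apply: word_cat_nth; rewrite size_mkseq.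
Qed.

(** Each monomial has at most one range over the source [z], so finitely many cylinders separate [y]
    from the others. *)
Lemma isolate_point l (y z : xpoint) : exists D, [/\ U D, D (val y)
  & forall (y' : xpoint) (k : int), reaches l (y', k, z) -> D (val y') -> y' = y].
Proof.
elim: l => [|q l [D [UD Dy HD]]].
  by exists X; split=> //; [exact: fa_top | exact: point_sub].
have [[y1 [k1 [y1y y1q]]] | nq] :=
    EM (exists (y1 : xpoint) (k1 : int), y <> y1 /\ msupp q.1 (y1, k1, z)).
  have [E [UE Ey nE]] := separate_points y1y.
  exists (D `&` E); split=> //; first exact: fa_cap.
  move=> y' k /orP[/asboolP y'q | /HD Dl] [Dy' Ey']; last exact: Dl.
  case: y'q => u /= [_ y'u zu _]; case: y1q => u1 /= [_ y1u zu1 _].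
  case: nE; suff <- : y' = y1 by [].
  by apply: val_inj; rewrite /= y'u y1u; move: zu; rewrite zu1 => /word_cat_inj ->.
exists D; split=> // y' k /orP[/asboolP y'q | /HD //] Dy'.
by apply: contrapT => ne; apply: nq; exists y', k; split=> // /esym.
Qed.

(** On functions concentrated on arrows from [z] to [z], that is on Laurent polynomials, a monomial
    acts as a shift of degree. *)
Lemma act_mon_fixed_source m F (y z : xpoint) (k : int) L :
  (forall (y' : xpoint) (k' : int), F (y', k', z, L) <> 0 -> y' = z) ->
  act (mon m) F (y, k, z, L) =
  if `[< msupp m (y, mdeg m, z) >] then F (z, k - mdeg m, z, L) else 0.
Proof.
move=> Fz; have [[u [y' [Du yu y'u]]] | nu] := EM (exists u y' : xpoint,
  [/\ mon_p m (val u), val y = word_cat (mon_s m) (val u)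
    & val y' = word_cat (mon_t m) (val u)]); last first.
  rewrite act_mon0 => [|u y' Du yu y'u]; last by apply: nu; exists u, y'.
  rewrite asboolF // => -[u /= [Du yu zu _]]; apply: nu.
  by exists (pt (follower_algebra_sub (mon_pP m) Du)), z.
rewrite (act_mon _ _ _ _ Du yu y'u); have [y'z | y'z] := EM (y' = z).
  rewrite asboolT; last by exists (val u); rewrite -y'z.
  by rewrite y'z /mdeg opprB addrA addrAC.
rewrite asboolF => [|[u' /= [_ yu' zu' _]]].
  by apply: contrapT => /Fz.
apply: y'z; apply: val_inj; rewrite /= zu' [LHS]y'u.
by move: yu'; rewrite [LHS]yu => /word_cat_inj ->.
Qed.

(** Degrees are bounded above by [reaches_bound], so the least distance from the bound is
    attained. *)
Lemma coef_top l (y z : xpoint) (k0 : int) : coef l (y, k0, z) <> 0 ->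
  exists k : int, coef l (y, k, z) <> 0 /\ forall j : int, k < j -> coef l (y, j, z) = 0.
Proof.
move=> nz; have [K HK] := reaches_bound l.
have zero (j : int) : K%:Z < j -> coef l (y, j, z) = 0.
  move=> Kj; apply: contrapT => /coef_reaches/HK; lia.
have ex : exists n : nat, coef l (y, K%:Z - n%:Z, z) != 0.
  exists `|K%:Z - k0|%N; apply/eqP.
  by rewrite (_ : K%:Z - _ = k0) //; have := HK _ _ _ (coef_reaches nz); lia.
have [n /eqP nn nmin] := ex_minnP ex; exists (K%:Z - n%:Z); split=> // j nj.
have [Kj | jK] := ltP K%:Z j; first exact: zero.
apply: contrapT => /eqP jnz; have := nmin `|K%:Z - j|%N.
by rewrite (_ : K%:Z - _ = j); [move=> /(_ jnz); lia | lia].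
Qed.

Lemma semiprime_no_free_letter (x : B) : (forall w : B, x * w * x = 0) -> x = 0.
Proof.
have [l xE] := combo_exists x; move=> xwx; rewrite xE.
apply: combo_eq0 => -[[y k0] z]; apply: contrapT => /coef_top[k [nz kmax]].
have [m [u /= [Du yu zu kE]]] := reaches_mon (coef_reaches nz).
have [D [UD Dy Dmax]] := isolate_point l y z.
(* The bisection inverse to that of [m], with the middle set enlarged to [X]: it takes the range [y]
   back to the source [z]. *)
pose m' := Monomial (mon_tP m) (fa_top X) (mon_sP m).
pose F := act (mon m' * gen_p D * x) vac.
have FE : F = act (mon m') (p_op D (act x vac)).
  by rewrite /F act_mul (act_mul (mon m')) act_p.
have xvac g : act x vac (g, [::]) = coef l g by rewrite xE act_combo.
have Xu := follower_algebra_sub (mon_pP m) Du.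
have F0 : F (z, 0, z, [::]) = coef l (y, k, z).
  rewrite FE (@act_mon m' _ z (pt Xu) y) //= /p_op /= asboolT //.
  by rewrite xvac kE add0r addrC.
(* [D] leaves only the range [y], and [k] is the top degree there; hence [F] is a polynomial in
   nonpositive degrees, with the top coefficient of [x] in degree 0. *)
have Fsupp (y1 : xpoint) (k1 : int) : F (y1, k1, z, [::]) <> 0 -> y1 = z /\ k1 <= 0.
  rewrite FE; have [[u1 [y' [_ y1u y'u]]] | nu] := EM (exists u1 y' : xpoint,
      [/\ X (val u1), val y1 = word_cat (mon_t m) (val u1)
        & val y' = word_cat (mon_s m) (val u1)]); last first.
    rewrite act_mon0 // => u1 y' /= Xu1 y1u y'u.
    by apply: nu; exists u1, y'.
  rewrite (@act_mon m' _ y1 u1 y') //= ?point_sub // /p_op /=; last exact: point_sub.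
  case: asboolP => // Dy'; rewrite xvac => nz1.
  have y'y := Dmax _ _ (coef_reaches nz1) Dy'; rewrite {}y'y in y'u nz1.
  have uu : val u1 = u by move: y'u; rewrite [LHS]yu => /word_cat_inj.
  split; first by apply: val_inj; rewrite y1u uu; exact/esym.
  apply: contrapT => k1pos; apply: nz1; apply: kmax; move: kE k1pos; lia.
have FB : act x F (y, k, z, [::]) = 0.
  by rewrite /F -act_mul mulrA xwx act0.
apply: nz; apply: domain_sqr; rewrite -{2}F0 -[RHS]FB xE act_sum.
pose T (q : monomial * R) := act (mon q.1 * cst q.2) F (y, k, z, [::]).
(* Collecting the monomials by degree gives the convolution product of the two Laurent
   polynomials. *)
have Tdeg (j : int) : \sum_(q <- l | `[< mdeg q.1 = j >]) T q =
    coef l (y, j, z) * F (z, k - j, z, [::]).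
  rewrite /coef mulr_suml big_mkcond [RHS]big_mkcond; apply: eq_bigr => -[m1 r1] _ /=.
  rewrite /T act_mul act_mon_fixed_source => [|y' k' /=]; last first.
    rewrite act_cst => nz'; suff [] : y' = z /\ k' <= 0 by [].
    by apply: Fsupp => F1; apply: nz'; rewrite F1 mulr0.
  rewrite act_cst; case: asboolP => [-> // | nj].
  rewrite asboolF // => -[u1 /= [_ _ _ ju]].
  by apply: nj; rewrite /mdeg ju.
(* Degree [k] gives the square of the top coefficient. Above [k] the coefficient of [x] vanishes,
   below [k] the value of [F] does. *)
rewrite (bigID (fun q => `[< mdeg q.1 = k >])) /= Tdeg subrr.
rewrite -[LHS]addr0; congr (_ + _); rewrite big_mkcond; apply/esym.
apply: (@sum_by_key _ _ _ _ (fun q => mdeg q.1) (eq^~ 0)) => [|v w -> ->|j] //.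
  by rewrite addr0.
have [-> | jk] := EM (j = k).
  by apply: big1 => q ->.
rewrite (eq_bigr T) => [|q /asboolP ->]; last by rewrite asboolF.
rewrite Tdeg; have [kj | jk'] := ltP k j; first by rewrite kmax // mul0r.
suff -> : F (z, k - j, z, [::]) = 0 by rewrite mulr0.
apply: contrapT => /Fsupp[_]; have /eqP := jk; lia.
Qed.

End NoFreeLetter.

Lemma sandwich_eq0 (x : B) : (forall w : B, x * w * x = 0) -> x = 0.
Proof.
have [[a nLa] | nfree] := EM (exists a, ~ language X [:: a]).
  exact: semiprime_free_letter nLa.
apply: semiprime_no_free_letter => a; apply: contrapT => nLa.
by apply: nfree; exists a.
Qed.

End Relations.

(** * The subshift algebra *)

Section Presentation.
Variables (A : Type) (X : set (nat -> A)) (R : comPzRingType).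
Hypothesis X_subshift : is_subshift X.

Local Notation U := (follower_algebra X).
Local Notation rels := (@subshift_rel A X R).
Local Notation S := (presented_alg rels).

(** Extended by zero outside the Boolean algebra, so that no membership proof appears in the
    argument. *)
Definition alg_p (D : set (nat -> A)) : S :=
  if pselect (U D) is left UD then pa_gen _ (PGen (exist _ D (mem_set UD))) else 0.
Definition alg_s (a : A) : S := pa_gen _ (SGen X a).
Definition alg_t (a : A) : S := pa_gen _ (TGen X a).

Lemma alg_pE (D : set_type U) : alg_p (val D) = pa_gen _ (PGen D).
Proof.
rewrite /alg_p; case: pselect => [UD | []]; last exact: set_valP.
by congr (pa_gen _ (PGen _)); apply: val_inj.
Qed.

Lemma eval_s_word w :
  expr_eval (pa_cst rels) (pa_gen _) (s_word X R w) = word_s alg_s w.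
Proof. by elim: w => /= [|a w ->]; rewrite ?rmorph1. Qed.

Lemma eval_t_word w :
  expr_eval (pa_cst rels) (pa_gen _) (t_word X R w) = word_t alg_t w.
Proof. by elim: w => /= [|a w ->]; rewrite ?rmorph1. Qed.

Definition subset_gen D (UD : U D) : set_type U := exist _ D (mem_set UD).

Lemma alg_pX : alg_p X = 1.
Proof.
have /= := presented_alg_rel (@rel_top A X R (subset_gen (fa_top X)) erefl).
by rewrite -alg_pE rmorph1.
Qed.

Lemma alg_p0 : alg_p set0 = 0.
Proof.
have /= := presented_alg_rel
  (@rel_empty A X R (subset_gen (follower_algebra0 X)) erefl).
by rewrite -alg_pE rmorph0.
Qed.

Lemma alg_pI D E : U D -> U E -> alg_p (D `&` E) = alg_p D * alg_p E.
Proof.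
move=> UD UE; have /= := presented_alg_rel (@rel_cap A X R (subset_gen UD)
  (subset_gen UE) (subset_gen (fa_cap UD UE)) erefl).
by rewrite -!alg_pE.
Qed.

Lemma alg_pU D E : U D -> U E ->
  alg_p (D `|` E) = alg_p D + alg_p E - alg_p (D `&` E).
Proof.
move=> UD UE; have /= := presented_alg_rel (@rel_cup A X R (subset_gen UD)
  (subset_gen UE) (subset_gen (fa_cup UD UE)) (subset_gen (fa_cap UD UE))
  erefl erefl).
by rewrite -!alg_pE.
Qed.

Lemma alg_sts a : alg_s a * alg_t a * alg_s a = alg_s a.
Proof. exact: (presented_alg_rel (@rel_sts A X R a)). Qed.

Lemma alg_tst a : alg_t a * alg_s a * alg_t a = alg_t a.
Proof. exact: (presented_alg_rel (@rel_tst A X R a)). Qed.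

Lemma alg_word_rel v w : language X v -> language X w ->
  word_s alg_s w * word_t alg_t v * word_s alg_s v * word_t alg_t w =
  alg_p (follower_set X v w).
Proof.
move=> Lv Lw; have /= := presented_alg_rel
  (@rel_word A X R v w (subset_gen (fa_gen Lv Lw)) Lv Lw erefl).
by rewrite -alg_pE !eval_s_word !eval_t_word.
Qed.

Lemma alg_ind (Q : S -> Prop) : (forall r, Q (pa_cst rels r)) ->
  (forall D, U D -> Q (alg_p D)) -> (forall a, Q (alg_s a)) ->
  (forall a, Q (alg_t a)) -> (forall b c, Q b -> Q c -> Q (b + c)) ->
  (forall b c, Q b -> Q c -> Q (b * c)) -> forall b, Q b.
Proof.
move=> Qcst Qp Qs Qt QD QM; elim/pa_ind => t; rewrite -expr_eval_class.
elim: t => /= [[D|a|a] | r | t Ht u Hu | t Ht | t Ht u Hu] //.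
- by rewrite -alg_pE; apply: Qp; apply: set_valP.
- exact: Qs.
- exact: Qt.
- exact: QD.
- by rewrite -mulN1r -(rmorph1 (pa_cst rels)) -rmorphN; apply: QM => //; exact: Qcst.
- exact: QM.
Qed.

(** * The action of the presented algebra on functions on paths *)

Section PathModule.
Variable x0 : xpoint X.
Local Notation operator := ((gpath X -> R) -> gpath X -> R).

Definition gen_op (g : subshift_gen X) : operator :=
  match g with
  | PGen D => p_op (val D)
  | SGen a => if `[< language X [:: a] >] then s_op X_subshift a
              else symbol_op x0 (a, false, false)
  | TGen a => if `[< language X [:: a] >] then t_op a
              else symbol_op x0 (a, true, true)
  end.

(** Arbitrary operators do not form a ring, as composition need not distribute over a sum of inner
    operators; [expr_op_linear] supplies the linearity that the congruence requires. *)
Fixpoint expr_op (t : expr R (subshift_gen X)) : operator :=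
  match t with
  | Gen g => gen_op g
  | Cst r => fun F P => r * F P
  | Add t u => fun F P => expr_op t F P + expr_op u F P
  | Opp t => fun F P => - expr_op t F P
  | Mul t u => fun F => expr_op t (expr_op u F)
  end.

Lemma expr_op_linear t : linear_op (expr_op t).
Proof.
elim: t => /= [[D|a|a] | c | t Ht u Hu | t Ht | t Ht u Hu].
- exact: p_op_linear.
- by rewrite /gen_op; case: ifP => _; [exact: s_op_linear | exact: symbol_op_linear].
- by rewrite /gen_op; case: ifP => _; [exact: t_op_linear | exact: symbol_op_linear].
- by move=> r F G; apply/funext => P; ring.
- by move=> r F G; apply/funext => P; rewrite Ht Hu; ring.
- by move=> r F G; apply/funext => P; rewrite Ht; ring.
- by move=> r F G; rewrite Hu Ht.
Qed.

Lemma expr_op_scale t r F P : expr_op t (fun Q => r * F Q) P = r * expr_op t F P.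
Proof.
have t0 : expr_op t (fun=> 0) = fun=> 0.
  apply/funext => Q; have e := expr_op_linear t (-1) (fun=> 0) (fun=> 0).
  transitivity (-1 * expr_op t (fun=> 0) Q + expr_op t (fun=> 0) Q).
    rewrite -[RHS]/((fun P => _) Q) -e.
    by congr expr_op; apply/funext => Q'; rewrite mulr0 addr0.
  by rewrite mulN1r addNr.
have := congr1 (fun G => G P) (expr_op_linear t r F (fun=> 0)).
by rewrite t0 addr0 => <-; congr expr_op; apply/funext => Q; rewrite addr0.
Qed.

Lemma expr_op_add t F G P :
  expr_op t (fun Q => F Q + G Q) P = expr_op t F P + expr_op t G P.
Proof.
have := congr1 (fun H => H P) (expr_op_linear t 1 F G).
by rewrite mul1r => <-; congr expr_op; apply/funext => Q; rewrite mul1r.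
Qed.

Lemma expr_op_s_word w F : letters_in X w ->
  expr_op (s_word X R w) F = word_s_op X_subshift w F.
Proof.
elim: w => [_ | a w IH [La Lw]] /=; last by rewrite IH // asboolT.
by apply/funext => P; rewrite mul1r.
Qed.

Lemma expr_op_t_word w F : letters_in X w ->
  expr_op (t_word X R w) F = word_t_op w F.
Proof.
elim: w F => [|a w IH] F => [_ | [La Lw]] /=; last by rewrite IH // asboolT.
by apply/funext => P; rewrite mul1r.
Qed.

Lemma expr_op_rel t u : rels t u -> expr_op t = expr_op u.
Proof.
have letters w : language X w -> letters_in X w by exact: language_letters_in.
case=> [D DX|D E K KDE|D E K L KDE LDE|D D0|a|a|v w D Lv Lw DE];
  apply/funext => F /=.
- apply/funext => P; rewrite mul1r /p_op DX asboolT //; exact: point_sub.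
- apply/funext => P; rewrite /p_op KDE asbool_and.
  by case: asboolP; case: asboolP.
- apply/funext => P; rewrite /p_op KDE LDE asbool_and asbool_or.
  by case: asboolP => _; case: asboolP => _ /=; ring.
- by apply/funext => P; rewrite /p_op D0 mul0r asboolF.
(* For a letter outside the language, [symbol_opM] is used twice, once for each of the adjacent
   pairs [p_a j_a] and [q_a i_a]. *)
- case: asboolP => La; last by rewrite (@symbol_opM _ _ _ _ a false false true)
    (@symbol_opM _ _ _ _ a false true false).
  apply/funext => -[[[y k] z] L]; rewrite /s_op /t_op.
  case: asboolP => // ya; case: pselect => [Xay | []].
    rewrite asboolT // subrK; congr (F (_, _, _, _)).
      by apply: val_inj; apply/funext.
  by rewrite -ya word_cat_head_shift; apply: point_sub.
- case: asboolP => La; last by rewrite (@symbol_opM _ _ _ _ a true true false)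
    (@symbol_opM _ _ _ _ a true false true).
  apply/funext => -[[[y k] z] L]; rewrite /s_op /t_op.
  by case: pselect => // Xay; rewrite asboolT // addrK.
- rewrite !expr_op_s_word ?expr_op_t_word; try exact: letters.
  by rewrite word_op DE.
Qed.

Lemma expr_op_cong t u : expr_cong rels t u -> expr_op t = expr_op u.
Proof.
elim=> //= {t u}.
- exact: expr_op_rel.
- by move=> t u v _ -> _ ->.
- by move=> t t' u u' _ -> _ ->.
- by move=> t t' _ ->.
- by move=> t t' u u' _ -> _ ->.
all: move=> *; apply/funext => F; apply/funext => P; rewrite ?rmorphD; try by ring.
- by rewrite expr_op_scale mul1r.
- exact: expr_op_add.
- by rewrite expr_op_scale.
Qed.

Definition alg_act (x : S) : operator := expr_op (pa_repr x).

Lemma alg_act_class t : alg_act (pa_class rels t) = expr_op t.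
Proof. exact/expr_op_cong/pa_repr_class. Qed.

Lemma alg_act_add (b c : S) F P : alg_act (b + c) F P = alg_act b F P + alg_act c F P.
Proof.
elim/pa_ind: b => t; elim/pa_ind: c => u.
by rewrite -[_ + _]/(pa_add _ _) pa_addE !alg_act_class.
Qed.

Lemma alg_act_mul (b c : S) F : alg_act (b * c) F = alg_act b (alg_act c F).
Proof.
elim/pa_ind: b => t; elim/pa_ind: c => u.
by rewrite -[_ * _]/(pa_mul _ _) pa_mulE !alg_act_class.
Qed.

Lemma alg_act_p D F : U D -> alg_act (alg_p D) F = p_op D F.
Proof. by move=> UD; rewrite -[D]/(val (subset_gen UD)) alg_pE alg_act_class. Qed.

Lemma alg_act_s a F : alg_act (alg_s a) F =
  if `[< language X [:: a] >] then s_op X_subshift a F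
  else symbol_op x0 (a, false, false) F.
Proof. by rewrite alg_act_class /=; case: ifP. Qed.

Lemma alg_act_t a F : alg_act (alg_t a) F =
  if `[< language X [:: a] >] then t_op a F else symbol_op x0 (a, true, true) F.
Proof. by rewrite alg_act_class /=; case: ifP. Qed.

Lemma alg_act_cst r F P : alg_act (pa_cst rels r) F P = r * F P.
Proof. by rewrite alg_act_class. Qed.

End PathModule.

Lemma alg_sandwich_eq0 (R_domain : GRing.integral_domain_axiom R) (x : S) :
  (forall w, x * w * x = 0) -> x = 0.
Proof.
(* The path module needs a base point. If [X] is empty, then [1 = p_X = p_0 = 0] and the algebra is
   zero. *)
have [[y Xy] | X0] := EM (exists y, X y); last first.
  move=> _; suff pX0 : alg_p X = 0 by rewrite -[x]mul1r -alg_pX pX0 mul0r.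
  rewrite -alg_p0; congr alg_p.
  by apply/seteqP; split=> // y Xy; apply: X0; exists y.
exact: (@sandwich_eq0 A X X_subshift S alg_p alg_s alg_t alg_pX alg_p0 alg_pI
  alg_pU alg_sts alg_tst alg_word_rel R (pa_cst rels) (pt Xy)
  (fun r b => pa_cst_central r b) (alg_act (pt Xy)) (@alg_act_add (pt Xy))
  (@alg_act_mul (pt Xy)) (@alg_act_cst (pt Xy)) (@alg_act_p (pt Xy))
  (@alg_act_s (pt Xy)) (@alg_act_t (pt Xy)) alg_ind R_domain).
Qed.

End Presentation.

Theorem corollary5p6 (A : Type) (A_nonempty : inhabited A)
    (X : set (nat -> A)) (X_subshift : is_subshift X)
    (R : comPzRingType) (R_domain : GRing.integral_domain_axiom R) :
  semiprime (unital_subshift_alg R X).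
Proof.
move=> I [I0 _ Iid] II; apply/seteqP; split=> [x Ix | _ -> //].
(* Elementwise criterion: for [x] in [I], the product of [x] and [w * x] lies in the square of
   [I]. *)
apply: (alg_sandwich_eq0 X_subshift R_domain) => w.
suff : [set 0] (x * (w * x)) by rewrite mulrA.
rewrite -II; exists 1%N, (fun=> x), (fun=> w * x); split=> // [_|].
  by have [] := Iid w x Ix.
by rewrite big_ord1.
Qed.
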